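(* Let $n\neq 2$ and let $f\not\equiv0$ be a binary $n$-ic form with integer coefficients. Then the ring $R_f$ is Gorenstein if and only if the form $f$ is primitive.
   Context: A binary $n$-ic form is $f=f_0x^n+f_1x^{n-1}y+\dots+f_ny^n$ with $f_i\in\mathbb{Z}$; it is primitive if its coefficients generate the unit ideal of $\mathbb{Z}$. If $f_0\neq0$, put $Q_f=\mathbb{Q}[\theta]/(f_0\theta^n+f_1\theta^{n-1}+\dots+f_n)$, $\zeta_0=1$, and $\zeta_k=f_0\theta^k+f_1\theta^{k-1}+\dots+f_{k-1}\theta$ for $1\le k\le n-1$. Then $R_f$ is the $\mathbb{Z}$-span of $\zeta_0,\dots,\zeta_{n-1}$, a subring of $Q_f$ that is free of rank $n$ over $\mathbb{Z}$. If $f\neq0$ but $f_0=0$, $R_f$ is defined as $R_{f'}$ for any $GL_2(\mathbb{Z})$-transform $f'$ of $f$ (by linear substitution of variables) with nonzero $x^n$-coefficient; up to isomorphism this does not depend on the choice.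
   Formalization: The degree is taken to be n ≥ 3: for n = 1 the claim fails, since R_f = Z is Gorenstein for f = 2x, which is not primitive; for n = 0 the ring R_f is zero for every nonzero constant f, e.g. f = 2, primitive or not. *)

(* Defs.v *)
From HB Require Import structures.
From mathcomp Require Import all_boot all_order all_algebra.
From mathcomp Require Import qpoly generic_quotient ring_quotient ring.
From mathcomp Require Import boolp.

Set Implicit Arguments.
Unset Strict Implicit.
Unset Printing Implicit Defensive.

Import GRing.Theory.
Local Open Scope ring_scope.
Local Open Scope quotient_scope.

(* The localization R_p of a commutative ring at a prime ideal, as classes of
   fractions r/s with s outside p; since R may have zero divisors, r/s = r'/s'
   means that u (r s' - r' s) = 0 for some u outside p. *)
Module Localization.
Section Localization.
Variables (R : comNzRingType) (p : prime_idealr R).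
Local Notation P := (p : pred R).

Record frac := Frac { pairf :> R * R; _ : pairf.2 \notin P }.
HB.instance Definition _ := [isSub for pairf].
HB.instance Definition _ := [Choice of frac by <:].

Lemma den_notin (x : frac) : x.2 \notin P. Proof. by case: x. Qed.

Lemma one_notin : 1 \notin P. Proof. by rewrite idealr1. Qed.

Lemma mul_notin (u v : R) : u \notin P -> v \notin P -> u * v \notin P.
Proof. by rewrite prime_idealrM negb_or => -> ->. Qed.

Definition eqf (x y : frac) : bool :=
  `[< exists2 u, u \notin P & u * (x.1 * y.2 - y.1 * x.2) = 0 >].

Lemma eqfP (x y : frac) :
  reflect (exists2 u, u \notin P & u * (x.1 * y.2 - y.1 * x.2) = 0) (eqf x y).
Proof. exact: asboolP. Qed.

Lemma eqf_refl : reflexive eqf.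
Proof. by move=> x; apply/eqfP; exists 1; [exact: one_notin | rewrite subrr mulr0]. Qed.

Lemma eqf_sym : symmetric eqf.
Proof.
move=> x y; apply/eqfP/eqfP => -[u uP e]; exists u => //;
  by rewrite -opprB mulrN e oppr0.
Qed.

Lemma eqf_trans : transitive eqf.
Proof.
move=> y x z /eqfP[u uP e] /eqfP[v vP e']; apply/eqfP; exists (u * v * y.2).
  by rewrite !mul_notin ?den_notin.
have -> : u * v * y.2 * (x.1 * z.2 - z.1 * x.2)
        = v * z.2 * (u * (x.1 * y.2 - y.1 * x.2))
        + u * x.2 * (v * (y.1 * z.2 - z.1 * y.2)) by ring.
by rewrite e e' !mulr0 addr0.
Qed.

Canonical eqf_equiv := EquivRel eqf eqf_refl eqf_sym eqf_trans.

Definition type := {eq_quot eqf}.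
HB.instance Definition _ : EqQuotient _ eqf type := EqQuotient.on type.
HB.instance Definition _ := Choice.on type.

Definition zerof : frac := @Frac (0, 1) one_notin.
Definition onef : frac := @Frac (1, 1) one_notin.
Definition oppf (x : frac) : frac := @Frac (- x.1, x.2) (den_notin x).
Definition addf (x y : frac) : frac :=
  @Frac (x.1 * y.2 + y.1 * x.2, x.2 * y.2)
    (mul_notin (den_notin x) (den_notin y)).
Definition mulf (x y : frac) : frac :=
  @Frac (x.1 * y.1, x.2 * y.2) (mul_notin (den_notin x) (den_notin y)).

Definition zero := lift_cst type zerof.
Definition one := lift_cst type onef.
Definition opp := lift_op1 type oppf.
Definition add := lift_op2 type addf.
Definition mul := lift_op2 type mulf.

Canonical pi_zero_morph := PiConst zero.
Canonical pi_one_morph := PiConst one.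

Lemma eqf_repr (x : frac) : eqf x (repr (\pi_type x)).
Proof. by apply/eqmodP; rewrite reprK. Qed.

Lemma pi_opp : {morph \pi : x / oppf x >-> opp x}.
Proof.
move=> x; unlock opp; apply/eqmodP/eqfP.
have /eqfP[u uP e] := eqf_repr x; exists u => //=.
by rewrite -[RHS]oppr0 -e; ring.
Qed.
Canonical pi_opp_morph := PiMorph1 pi_opp.

Lemma pi_add : {morph \pi : x y / addf x y >-> add x y}.
Proof.
move=> x y; unlock add; apply/eqmodP/eqfP.
have /eqfP[u uP] := eqf_repr x; have /eqfP[v vP] := eqf_repr y.
set y' := repr _; set x' := repr _ => e' e.
exists (u * v); first exact: mul_notin.
rewrite /=; transitivity (v * y.2 * y'.2 * (u * (x.1 * x'.2 - x'.1 * x.2))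
  + u * x.2 * x'.2 * (v * (y.1 * y'.2 - y'.1 * y.2))); first by ring.
by rewrite e e' !mulr0 addr0.
Qed.
Canonical pi_add_morph := PiMorph2 pi_add.

Lemma pi_mul : {morph \pi : x y / mulf x y >-> mul x y}.
Proof.
move=> x y; unlock mul; apply/eqmodP/eqfP.
have /eqfP[u uP] := eqf_repr x; have /eqfP[v vP] := eqf_repr y.
set y' := repr _; set x' := repr _ => e' e.
exists (u * v); first exact: mul_notin.
rewrite /=; transitivity (v * y.1 * y'.2 * (u * (x.1 * x'.2 - x'.1 * x.2))
  + u * x'.1 * x.2 * (v * (y.1 * y'.2 - y'.1 * y.2))); first by ring.
by rewrite e e' !mulr0 addr0.
Qed.
Canonical pi_mul_morph := PiMorph2 pi_mul.

Lemma eq_frac (x y : frac) :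
  x.1 * y.2 = y.1 * x.2 -> x = y %[mod type].
Proof.
move=> e; apply/eqmodP/eqfP; exists 1; first exact: one_notin.
by rewrite e subrr mulr0.
Qed.

Lemma addA : associative add.
Proof.
elim/quotW=> x; elim/quotW=> y; elim/quotW=> z; rewrite !piE.
by apply: eq_frac => /=; ring.
Qed.

Lemma addC : commutative add.
Proof.
by elim/quotW=> x; elim/quotW=> y; rewrite !piE; apply: eq_frac => /=; ring.
Qed.

Lemma add0 : left_id zero add.
Proof. by elim/quotW=> x; rewrite !piE; apply: eq_frac => /=; ring. Qed.

Lemma addN : left_inverse zero opp add.
Proof. by elim/quotW=> x; rewrite !piE; apply: eq_frac => /=; ring. Qed.

HB.instance Definition _ := GRing.isZmodule.Build type addA addC add0 addN.

Lemma mulA : associative mul.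
Proof.
elim/quotW=> x; elim/quotW=> y; elim/quotW=> z; rewrite !piE.
by apply: eq_frac => /=; ring.
Qed.

Lemma mulC : commutative mul.
Proof.
by elim/quotW=> x; elim/quotW=> y; rewrite !piE; apply: eq_frac => /=; ring.
Qed.

Lemma mul1 : left_id one mul.
Proof. by elim/quotW=> x; rewrite !piE; apply: eq_frac => /=; ring. Qed.

Lemma mul_addl : left_distributive mul add.
Proof.
elim/quotW=> x; elim/quotW=> y; elim/quotW=> z; rewrite !piE.
by apply: eq_frac => /=; ring.
Qed.

Lemma one_neq0 : one != zero.
Proof.
rewrite !piE; apply/negP => /eqfP[u /negP uP /=].
by rewrite !mulr1 subr0 mulr1 => u0; apply: uP; rewrite u0 idealr0.
Qed.

HB.instance Definition _ :=
  GRing.Zmodule_isComNzRing.Build type mulA mulC mul1 mul_addl one_neq0.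

End Localization.
End Localization.
HB.export Localization.

Definition localization (R : comNzRingType) (p : prime_idealr R) :
  comNzRingType := Localization.type p.

(* [idealr R] ranges over the proper ideals; the unit ideal is generated by 1. *)
Definition noetherian (R : comNzRingType) : Prop :=
  forall I : idealr R, exists s : seq R, forall x : R,
    x \in (I : pred R) <->
      exists c : 'I_(size s) -> R, x = \sum_(i < size s) c i * s`_i.

Definition injective_module (R : comNzRingType) (E : lmodType R) : Prop :=
  forall (A B : lmodType R) (i : {linear A -> B}) (h : {linear A -> E}),
    injective i -> exists k : {linear B -> E}, forall a, k (i a) = h a.

(* M has an injective resolution 0 -> M -> E_0 -> E_1 -> ... that vanishes in
   degrees greater than some d. *)
Definition finite_injective_dimension (R : comNzRingType) (M : lmodType R) :
    Prop :=
  exists (d : nat) (E : nat -> lmodType R) (e : {linear M -> E 0%N})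
         (delta : forall i, {linear E i -> E i.+1}),
    [/\ forall i, injective_module (E i),
        injective e,
        forall x, delta 0%N x = 0 <-> exists m, x = e m,
        forall i x, delta i.+1 x = 0 <-> exists y, x = delta i y
      & forall i, (d < i)%N -> forall x : E i, x = 0].

Definition gorenstein (R : comNzRingType) : Prop :=
  noetherian R /\
  forall p : prime_idealr R,
    finite_injective_dimension ((localization p)^o : lmodType (localization p)).

(* The row (f_0, ..., f_n) stands for f_0 x^n + f_1 x^(n-1) y + ... + f_n y^n. *)
Definition binary_form (n : nat) := 'rV[int]_n.+1.

Definition primitive_form (n : nat) (f : binary_form n) : Prop :=
  exists u : 'I_n.+1 -> int, \sum_i u i * f 0 i = 1.

(* The form f(g_00 x + g_01 y, g_10 x + g_11 y), its coefficients being read off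
   after setting y = 1. *)
Definition subst_form (n : nat) (g : 'M[int]_2) (f : binary_form n) :
    binary_form n :=
  \row_i (\sum_(j < n.+1) f 0 j *:
      ((g 0 0 *: 'X + (g 0 1)%:P) ^+ (n - j) *
       (g 1 0 *: 'X + (g 1 1)%:P) ^+ j))`_(n - i).

Fact zz_identity (R : comNzRingType) (t u v a b : R) :
  t * (u + a) * v = u * (t * (v + b)) + (t * (v + b) * a + t * (u + a) * - b).
Proof. by ring. Qed.

Section FormRing.
Variables (n : nat) (f : binary_form n).

Definition dehomogenized : {poly rat} :=
  \sum_(i < n.+1) (f 0 i)%:~R *: 'X^(n - i).

(* {poly %/ h} is the quotient by h only for h monic of positive degree, which
   is the case here as soon as f_0 <> 0 and 0 < n. *)
Definition form_algebra : comNzRingType :=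
  {poly %/ ((f 0 0)%:~R^-1 *: dehomogenized)}.

Definition theta : form_algebra := 'qX.

Definition zeta (k : nat) : form_algebra :=
  if k is 0 then 1 else \sum_(j < k) theta ^+ (k - j) *~ f 0 (inord j).

(* n.-1.+1 is n, except that the span is that of 1 when n = 0. *)
Definition form_ring_pred : pred form_algebra :=
  fun x => `[< exists c : 'I_n.-1.+1 -> int, x = \sum_(k < n.-1.+1) zeta k *~ c k >].

Lemma zeta_in_span (k : nat) : (k < n.-1.+1)%N -> form_ring_pred (zeta k).
Proof.
move=> kn; apply/asboolP; exists (fun i => (i == Ordinal kn)%:R).
rewrite (bigD1 (Ordinal kn)) //= eqxx mulr1z big1 ?addr0 // => i /negPf ->.
by rewrite mulr0z.
Qed.

Lemma span_lin (a : int) (x y : form_algebra) :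
  form_ring_pred x -> form_ring_pred y -> form_ring_pred (x *~ a + y).
Proof.
move=> /asboolP[c ->] /asboolP[d ->]; apply/asboolP.
exists (fun i => c i * a + d i).
rewrite mulrz_suml -big_split /=; apply: eq_bigr => i _.
by rewrite mulrzDr mulrzA.
Qed.

Lemma span1 : form_ring_pred 1. Proof. exact: (@zeta_in_span 0). Qed.

Lemma span0 : form_ring_pred 0.
Proof. by have := span_lin (-1) span1 span1; rewrite mulrNz mulr1z addNr. Qed.

Lemma spanZ (a : int) x : form_ring_pred x -> form_ring_pred (x *~ a).
Proof. by move=> hx; rewrite -[_ *~ _]addr0; apply: span_lin => //; exact: span0. Qed.

Lemma spanD x y :
  form_ring_pred x -> form_ring_pred y -> form_ring_pred (x + y).
Proof. by move=> hx hy; rewrite -[x]mulr1z; exact: span_lin. Qed.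

(* The formula for zeta_k, which gives 0 for k = 0 and -f_n for k = n. *)
Let z (k : nat) : form_algebra :=
  \sum_(j < k) theta ^+ (k - j) *~ f 0 (inord j).

Let zS k : z k.+1 = theta * (z k + 1 *~ f 0 (inord k)).
Proof.
rewrite /z big_ord_recr /= subSnn expr1 mulrDr mulr_sumr mulrzAr mulr1.
congr (_ + _); apply: eq_bigr => j _.
by rewrite mulrzAr -exprS subSn // ltnW.
Qed.

Let theta_root : f 0 0 != 0 -> (0 < n)%N ->
  \sum_(j < n.+1) theta ^+ (n - j) *~ f 0 j = 0.
Proof.
move=> f0 n0; set h := (f 0 0)%:~R^-1 *: dehomogenized.
have f0' : (f 0 0)%:~R != 0 :> rat by rewrite intr_eq0.
have szd : size dehomogenized = n.+1 /\ lead_coef dehomogenized = (f 0 0)%:~R.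
  rewrite /dehomogenized big_ord_recl subn0.
  set a := _ *: 'X^n; set b := \sum_(_ < _) _.
  have sa : size a = n.+1 by rewrite size_scale // size_polyXn.
  have sb : (size b < size a)%N.
    rewrite sa ltnS; apply: leq_trans (size_sum _ _ _) _.
    apply/bigmax_leqP => i _; apply: leq_trans (size_scale_leq _ _) _.
    by rewrite size_polyXn /= /bump /= add1n subnSK // leq_subr.
  by rewrite size_polyDl // lead_coefDl // sa lead_coefZ lead_coefXn mulr1.
have hE : mk_monic h = h.
  rewrite /mk_monic monicE lead_coefZ size_scale ?invr_eq0 // szd.1 szd.2.
  by rewrite mulVf // eqxx ltnS n0.
have dz : in_qpoly h dehomogenized = 0.
  have -> : dehomogenized = (f 0 0)%:~R *: h by rewrite scalerA divff ?scale1r.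
  rewrite linearZ /=; apply/val_inj => /=.
  by rewrite hE Pdiv.RingMonic.rmodpp ?scaler0 // -hE monic_mk_monic.
rewrite -[RHS]dz [in RHS]/dehomogenized raddf_sum; apply: eq_bigr => i _.
rewrite scaler_int raddfMz; congr (_ *~ _).
exact/esym/(rmorphXn (in_qpoly h : {rmorphism {poly rat} -> {poly %/ h}})).
Qed.

Let z_last : (0 < n)%N -> exists m : int, z n = 1 *~ m.
Proof.
move=> n0; have [f0|f0] := eqVneq (f 0 0) 0.
  exists 0; rewrite /z big1 // => j _; suff -> : theta = 0.
    by rewrite expr0n subn_eq0 leqNgt ltn_ord mul0rz.
  rewrite /theta /qpolyX; apply/val_inj => /=.
  rewrite f0 invr0 scale0r /mk_monic size_poly0 /=.
  by rewrite Pdiv.RingMonic.rmodpp ?monicX.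
exists (- f 0 ord_max); have := theta_root f0 n0.
rewrite big_ord_recr /= subnn expr0 mulrNz => /eqP.
rewrite addr_eq0 => /eqP <-; apply: eq_bigr => j _.
by congr (_ *~ f 0 _); apply/val_inj; rewrite /= inordK // ltnS ltnW.
Qed.

Let z_span k : (0 < n)%N -> (k <= n)%N -> form_ring_pred (z k).
Proof.
move=> n0; rewrite leq_eqVlt => /orP[/eqP ->|kn].
  by have [m ->] := z_last n0; exact: spanZ span1.
case: k kn => [|k] kn; first by rewrite /z big_ord0; exact: span0.
by apply: (@zeta_in_span k.+1); rewrite prednK.
Qed.

Let span_zz i j : (0 < n)%N -> (i <= n)%N -> (j <= n)%N ->
  form_ring_pred (z i * z j).
Proof.
move=> n0; elim: i j => [|i IHi] j ltin jn.
  by rewrite /z big_ord0 mul0r; exact: span0.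
move: jn; rewrite leq_eqVlt => /orP[/eqP ->|jn].
  have [m ->] := z_last n0; rewrite mulrzAr mulr1.
  by apply: spanZ; exact: z_span.
have -> : z i.+1 * z j = z i * z j.+1
    + (z j.+1 *~ f 0 (inord i) + z i.+1 *~ (- f 0 (inord j))).
  by rewrite !zS (zz_identity _ _ _ _ (1 *~ f 0 (inord j))) -mulrNz
    -[_ *~ f 0 _ in RHS]mulr1 !(mulrzAr, mulr1).
apply: spanD; first exact: IHi (ltnW ltin) jn.
by apply: spanD; apply: spanZ; apply: z_span => //; apply: ltnW.
Qed.

Let span_zetazeta i j : (i < n.-1.+1)%N -> (j < n.-1.+1)%N ->
  form_ring_pred (zeta i * zeta j).
Proof.
case: i j => [|i] [|j] lin ljn; rewrite ?mul1r ?mulr1; try exact: zeta_in_span.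
have n0 : (0 < n)%N by case: (n) lin.
rewrite prednK // in lin ljn; exact: (@span_zz i.+1 j.+1) (ltnW lin) (ltnW ljn).
Qed.

Let span_sum I (r : seq I) (F : I -> form_algebra) :
  (forall i, form_ring_pred (F i)) -> form_ring_pred (\sum_(i <- r) F i).
Proof. move=> h; by elim/big_ind : _ => //; [exact: span0 | exact: spanD]. Qed.

Fact form_ring_subring : subring_closed form_ring_pred.
Proof.
split=> [|x y hx hy|x y]; first exact: span1.
  by have := span_lin (-1) hy hx; rewrite mulrNz mulr1z addrC.
move=> /asboolP[c ->] /asboolP[d ->]; rewrite mulr_suml.
apply: span_sum => i; rewrite mulr_sumr; apply: span_sum => j.
by rewrite mulrzAl mulrzAr; do 2!apply: spanZ; exact: span_zetazeta.
Qed.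

HB.instance Definition _ :=
  GRing.isSubringClosed.Build form_algebra form_ring_pred form_ring_subring.

Record form_ring := FormRing {
  form_ring_val :> form_algebra;
  _ : form_ring_val \in form_ring_pred
}.
HB.instance Definition _ := [isSub for form_ring_val].
HB.instance Definition _ := [Choice of form_ring by <:].
HB.instance Definition _ := [SubChoice_isSubComNzRing of form_ring by <:].

End FormRing.

(* [defines_ring f f']: the ring R_f of a nonzero form f may be taken to be
   [form_ring f'], that is f' = f if f_0 <> 0, and otherwise f' is any
   GL_2(Z)-transform of f with nonzero x^n-coefficient. *)
Variant defines_ring (n : nat) (f : binary_form n) : binary_form n -> Prop :=
| DefinesSelf of f 0 0 != 0 : defines_ring f f
| DefinesTransform (g : 'M[int]_2) of f 0 0 = 0 & g \in unitmx
    & subst_form g f 0 0 != 0 : defines_ring f (subst_form g f).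

Lemma coef_linear_exp (a b : int) k :
  ((a *: 'X + b%:P) ^+ k)`_k = a ^+ k /\
  (size ((a *: 'X + b%:P) ^+ k) <= k.+1)%N.
Proof.
elim: k => [|k [IHc IHs]]; first by rewrite !expr0 coefC size_poly1.
rewrite [_ ^+ k.+1]exprS [a ^+ _]exprS mulrDl; split.
  rewrite coefD -scalerAl coefZ coefXM /= IHc coefCM.
  by rewrite [X in b * X]nth_default // mulr0 addr0.
apply: leq_trans (size_polyD _ _) _; rewrite geq_max -scalerAl -mul_polyC.
by rewrite !mul_polyC !(leq_trans (size_scale_leq _ _)) ?(leqW IHs) //
  (leq_trans (size_polyMleq _ _)) // size_polyX.
Qed.

Lemma subst_form_shear (n : nat) (g : 'M[int]_2) (f : binary_form n) :
  g 0 0 = 1 -> g 0 1 = 0 ->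
  subst_form g f 0 0 = \sum_(j < n.+1) f 0 j * g 1 0 ^+ j.
Proof.
move=> g00 g01; rewrite mxE subn0 coef_sum; apply: eq_bigr => j _.
rewrite coefZ g00 g01 scale1r addr0 coefXnM ltnNge leq_subr /=; congr (_ * _).
rewrite subKn; last by rewrite -ltnS.
exact: (coef_linear_exp _ _ _).1.
Qed.

Lemma defines_ring_exists (n : nat) (f : binary_form n) :
  f != 0 -> exists f', defines_ring f f'.
Proof.
move=> f_neq0; have [f0|f0] := eqVneq (f 0 0) 0; last first.
  by exists f; exact: DefinesSelf.
pose q : {poly int} := rVpoly f.
have q_neq0 : q != 0.
  by apply: contra_neq f_neq0 => q0; rewrite -[f]rVpolyK -/q q0 linear0.
have [a qa] : exists a : int, ~~ root q a.
  apply: contrapT => /forallNP qr.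
  have: all (root q) [seq Posz k | k <- iota 0 (size q)].
    by apply/allP => _ /mapP[k _ ->]; apply: contrapT => /negP; exact: qr.
  move=> /(max_poly_roots q_neq0); rewrite map_inj_uniq ?iota_uniq; last first.
    by move=> x y [].
  by move=> /(_ isT); rewrite size_map size_iota ltnn.
pose g : 'M[int]_2 := \matrix_(i, j) (if i == 0 then (j == 0)%:R
                                      else if j == 0 then a else 1).
exists (subst_form g f); apply: DefinesTransform => //.
  rewrite unitmxE det_trig; last first.
    by apply/is_trig_mxP => -[[|[|//]] ?] [[|[|//]] ?]; rewrite ?mxE.
  by rewrite big1 ?unitr1 // => -[[|[|//]] ?] _; rewrite mxE.
rewrite subst_form_shear ?mxE //=.
apply: contra qa; rewrite rootE horner_poly => /eqP qa0.
apply/eqP; rewrite -[RHS]qa0; apply: eq_bigr => j _; congr (_ * _).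
by rewrite insubT //= => ?; congr (f 0 _); apply/val_inj.
Qed.

(* Main.v *)
(* Write R for the ring of a form f with f_0 <> 0, and K = Q (x) R.

   If f is primitive, let tau : K -> Q be the coefficient of zeta_(n-1) in the
   basis zeta. The dual lattice { x | tau (x R) in Z } has the basis
   1, theta, ..., theta^(n-2), zeta_(n-1) + f_(n-1); it is the ideal
   (1, theta)^(n-2). At every prime q of R, primitivity forces theta or 1/theta
   into R_q, so that this ideal is locally principal and R_q is locally
   isomorphic to Hom_Z(R, Z). Hence 0 -> R_q -> K_q -> K_q / R_q -> 0 is an
   injective resolution: its last two terms are the q-parts of Hom_Z(R, Q) and
   Hom_Z(R, Q/Z).

   If a prime p divides f, then m = (p, zeta_1, ..., zeta_(n-1)) is a prime
   ideal, m = p R' for the ring R' of f / p, and there is an exact sequence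
   0 -> m^(n-1) -> R^n -> m -> 0. So the vanishing of Ext^(i+1)(m, -) on an
   R_m-module implies that of Ext^i(m, -), and finite injective dimension would
   give Ext^1(m, R_m) = 0; for n > 2 this is contradicted by
   r |-> r_1 zeta_2 / p on the syzygies r of (p, zeta_1, ..., zeta_(n-1)). *)

Require Import Defs.
From mathcomp Require Import all_boot all_order all_algebra.
From HB Require Import structures.
From mathcomp Require Import qpoly generic_quotient ring_quotient ring zify.
From mathcomp Require Import boolp classical_sets.

Set Implicit Arguments.
Unset Strict Implicit.
Unset Printing Implicit Defensive.

Import Order.TTheory GRing.Theory Num.Theory.
Local Open Scope ring_scope.
Local Open Scope quotient_scope.

(** * Divisible groups *)

(** The algebra K is only Artinian, possibly with nilpotents, and q may be minimal as well as
    maximal. All cases are treated at once through an idempotent e of K: K_q is the direct factor e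
    K. Likewise Hom_Z(R, Q/Z) is K modulo the dual lattice, and its q-part is described by
    representatives in K. Injectivity is not tested on ideals: each module is a direct factor of
    some Hom_Z(R, D) with D divisible, which reduces the question to extending additive maps into D.
    In the converse a resolution is given and nothing is known of its terms but injectivity,
    exactness and eventual vanishing. The vanishing of Ext^1(m, ker delta) is therefore phrased as
    an extension property of functions on a free module that are linear on syzygies, and it is
    carried down the given resolution from the degrees where the terms vanish. A single one of the n
    - 1 copies of m inside R^n suffices for this descent. The generator zeta_2 enters only in the
    final contradiction, and this is where n > 2 is spent. *)

Definition divisible (D : zmodType) : Prop :=
  forall (x : D) (m : nat), (0 < m)%N -> exists y, y *+ m = x.

Section DivisibleExtension.
Variables (A B D : zmodType) (i : {additive A -> B}) (h : {additive A -> D}).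
Hypotheses (i_inj : injective i) (divD : divisible D).

(** Partial extensions of [h] along [i] are encoded by their graphs, so that the union of a chain is
    again a candidate for Zorn's lemma. The last clause makes the graph single-valued. *)
Definition extension_graph (G : set (B * D)) : Prop :=
  [/\ forall a, G (i a, h a),
      forall u v, G u -> G v -> G (u - v)
    & forall d, G (0, d) -> d = 0].

Let pair_mulz (b : B) (d : D) m : (b, d) *~ m = (b *~ m, d *~ m).
Proof.
have fstM : fst ((b, d) *~ m) = b *~ m := raddfMz (@fst B D) m (b, d).
have sndM : snd ((b, d) *~ m) = d *~ m := raddfMz (@snd B D) m (b, d).
by rewrite [LHS]surjective_pairing fstM sndM.
Qed.

Let graph0 G : extension_graph G -> G 0.
Proof. by case=> Gh Gs _; have := Gs _ _ (Gh 0) (Gh 0); rewrite subrr. Qed.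

Let graphN G u : extension_graph G -> G u -> G (- u).
Proof.
by move=> eG Gu; have [_ Gs _] := eG; have := Gs _ _ (graph0 eG) Gu; rewrite sub0r.
Qed.

Let graphD G u v : extension_graph G -> G u -> G v -> G (u + v).
Proof.
move=> eG Gu Gv; have [_ Gs _] := eG.
by have := Gs _ _ Gu (graphN eG Gv); rewrite opprK.
Qed.

Let graphMz G u m : extension_graph G -> G u -> G (u *~ m).
Proof.
move=> eG Gu; have pos k : G (u *+ k).
  elim: k => [|k IH]; first by rewrite mulr0n; exact: graph0.
  by rewrite mulrS; exact: graphD.
by case: m => k; [exact: pos | apply: graphN => //; exact: pos].
Qed.

Let graph_fun G b d d' : extension_graph G -> G (b, d) -> G (b, d') -> d = d'.
Proof.
move=> [_ Gs G0] Gd Gd'; apply/eqP; rewrite -subr_eq0; apply/eqP/G0.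
have : G (b - b, d - d') := Gs _ _ Gd Gd'.
by rewrite subrr.
Qed.

(** [d0] is the value to give to [b]. If some positive multiple of [b] lies in the domain, the least
    one, [b *+ m], divides all the others, and its value is divided by [m]; otherwise any value
    works. *)
Lemma extension_graph_adjoin G b : extension_graph G ->
  exists d0, forall m d, G (b *~ m, d) -> d = d0 *~ m.
Proof.
move=> eG.
have [[m0 m0P]|no] := pselect (exists m, (0 < m)%N && `[< exists d, G (b *+ m, d) >]).
  pose ex : exists m, (0 < m)%N && `[< exists d, G (b *+ m, d) >] :=
    ex_intro _ m0 m0P.
  case: (ex_minnP ex) => m /andP[m_gt0 /asboolP[d1 Gd1]] min.
  have [d0 d0m] := divD d1 m_gt0; exists d0 => k d Gk.
  have m_neq0 : m%:Z != 0 by rewrite -lt0n.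
  have Gr : G (b *~ (k %% m)%Z, d - d1 *~ (k %/ m)%Z).
    have := graphD eG Gk (graphN eG (graphMz (k %/ m)%Z eG Gd1)).
    rewrite (_ : _ + _ = (b *~ k - b *+ m *~ (k %/ m)%Z, d - d1 *~ (k %/ m)%Z)).
      by rewrite pmulrn -mulrzA -mulrzBr {1}(divz_eq k m) mulrC addrAC subrr add0r.
    by rewrite pair_mulz.
  have r0 : (k %% m)%Z = 0.
    have := modz_ge0 k m_neq0; have := ltz_pmod k (m_gt0 : 0 < m%:Z).
    move: Gr; case: (k %% m)%Z => // -[//|r] Gr lt_rm _.
    have := min r.+1 (introT andP (conj isT (asboolT (ex_intro _ _ Gr)))).
    by rewrite leqNgt -ltz_nat lt_rm.
  rewrite r0 mulr0z in Gr; case: eG => _ _ /(_ _ Gr)/eqP; rewrite subr_eq0 => /eqP ->.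
  by rewrite -d0m pmulrn -mulrzA {2}(divz_eq k m) r0 addr0 mulrC.
exists 0 => m d Gm; rewrite mul0rz.
have [m0|m_neq0] := eqVneq m 0.
  by move: Gm; rewrite m0 mulr0z; case: eG => _ _; exact.
case: no; exists `|m|%N; rewrite absz_gt0 m_neq0; apply/asboolP.
case: m Gm {m_neq0} => k Gm; first by exists d.
exists (- d); have : G (- (b *~ Negz k), - d) := graphN eG Gm.
by rewrite NegzE mulrNz opprK.
Qed.

Lemma divisible_extension : exists g : {additive B -> D}, forall a, g (i a) = h a.
Proof.
pose P (G : set (B * D)) := G = set0 \/ extension_graph G.
have [|G [PG maxG]] := @Zorn_bigcup _ P.
  move=> F FP totF; have [[X0 FX0 eX0]|no] := pselect (exists2 X, F X & extension_graph X).
    right; have [X0h _ _] := eX0; have gX X u : F X -> X u -> extension_graph X.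
      by move=> /FP[->|].
    split=> [a|u v [X FX Xu] [Y FY Yv]|d [X FX Xd]].
    - by exists X0.
    - have [XY|YX] := totF _ _ FX FY.
        exists Y => //; have [_ Ys _] := gX _ _ FY Yv.
        by apply: Ys => //; exact: XY.
      exists X => //; have [_ Xs _] := gX _ _ FX Xu.
      by apply: Xs => //; exact: YX.
    - by have [_ _ Xf] := gX _ _ FX Xd; exact: Xf.
  left; apply/seteqP; split=> // u [X FX Xu].
  have [X0|eX] := FP _ FX; first by rewrite X0 in Xu.
  by case: no; exists X.
have eG : extension_graph G.
  case: PG => // G0; exfalso; pose G1 : set (B * D) := fun u => exists a, u = (i a, h a).
  apply: (maxG G1); last first.
    right; split=> [a|_ _ [a ->] [b ->]|d [a [a0 ->]]]; first by exists a.
      by exists (a - b); rewrite !raddfB.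
    by rewrite (_ : a = 0) ?raddf0 //; apply: i_inj; rewrite -a0 raddf0.
  rewrite G0; split=> //; move=> /(_ (i 0, h 0)) H; apply: H.
  by exists 0.
have totG b : exists d, G (b, d).
  have [d0 d0P] := extension_graph_adjoin b eG.
  apply: contrapT => no.
  pose G1 : set (B * D) := fun u => exists m, G (u.1 - b *~ m, u.2 - d0 *~ m).
  have [Gh Gs G0] := eG.
  apply: (maxG G1); last first.
    right; split=> [a|u v [m Gm] [k Gk]|d [m /=]].
    - by exists 0; rewrite !mulr0z !subr0; exact: Gh.
    - exists (m - k); have : G (u.1 - b *~ m - (v.1 - b *~ k),
          u.2 - d0 *~ m - (v.2 - d0 *~ k)) := Gs _ _ Gm Gk.
      by rewrite !mulrzBr !opprD !(addrACA _ (- (_ *~ m))).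
    - rewrite sub0r -mulrNz => /d0P /eqP.
      by rewrite mulrNz subr_eq addNr => /eqP.
  split=> [u Gu|]; first by exists 0; rewrite !mulr0z !subr0 -surjective_pairing.
  move=> /(_ (b, d0)) H; apply: no; exists d0; apply: H.
  by exists 1; rewrite /= !subrr; exact: graph0.
have [g gP] := choice totG.
have g_add : zmod_morphism g.
  move=> x y; apply: (graph_fun eG (gP _)).
  by have [_ Gs _] := eG; exact: (Gs _ _ (gP x) (gP y)).
pose gM := GRing.isZmodMorphism.Build B D g g_add.
pose g' : {additive B -> D} := HB.pack g gM.
exists g' => a /=; apply: (graph_fun eG (gP _)).
by have [Gh _ _] := eG.
Qed.

End DivisibleExtension.

(** * Quotient modules and localization maps *)

Section QuotientModule.
Variables (R : nzRingType) (V : lmodType R) (U : zmodClosed V).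
Hypothesis UZ : forall (a : R) (v : V), v \in U -> a *: v \in U.

(** Stability under scalars is an argument of the type, so that the scalar action can be attached to
    it as an instance. *)
Definition module_quotient of
  (forall (a : R) (v : V), v \in U -> a *: v \in U) := Quotient.quot U.
Local Notation Q := (module_quotient UZ).

HB.instance Definition _ := GRing.Zmodule.on Q.

Definition module_quotient_pi (v : V) : Q := \pi_(Quotient.quot U) v.

Definition module_quotient_scale (a : R) (x : Q) : Q :=
  module_quotient_pi (a *: repr (x : Quotient.quot U)).

Lemma module_quotient_piP (u v : V) :
  module_quotient_pi u = module_quotient_pi v <-> u - v \in U.
Proof. by rewrite Quotient.idealrBE; split=> [e|/eqP//]; exact/eqP. Qed.

Lemma module_quotient_pi_sur (x : Q) : exists v, module_quotient_pi v = x.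
Proof. by exists (repr (x : Quotient.quot U)); rewrite /module_quotient_pi reprK. Qed.

Lemma module_quotient_pi_zmod : zmod_morphism module_quotient_pi.
Proof. exact: (raddfB (\pi_(Quotient.quot U))). Qed.

HB.instance Definition _ :=
  GRing.isZmodMorphism.Build V Q module_quotient_pi module_quotient_pi_zmod.

Lemma module_quotient_piZ a v :
  module_quotient_scale a (module_quotient_pi v) = module_quotient_pi (a *: v).
Proof.
apply/module_quotient_piP; rewrite -scalerBr; apply: UZ.
by rewrite Quotient.idealrBE reprK.
Qed.

Fact module_quotient_scaleA a b x : module_quotient_scale a (module_quotient_scale b x)
  = module_quotient_scale (a * b) x.
Proof.
by have [v <-] := module_quotient_pi_sur x; rewrite !module_quotient_piZ scalerA.
Qed.

Fact module_quotient_scale1 : left_id 1 module_quotient_scale.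
Proof.
by move=> x; have [v <-] := module_quotient_pi_sur x; rewrite !module_quotient_piZ scale1r.
Qed.

Fact module_quotient_scaleDr : right_distributive module_quotient_scale +%R.
Proof.
move=> a x y; have [v <-] := module_quotient_pi_sur x.
have [u <-] := module_quotient_pi_sur y.
by rewrite -raddfD !module_quotient_piZ -raddfD scalerDr.
Qed.

Fact module_quotient_scaleDl x :
  {morph module_quotient_scale^~ x : a b / a + b}.
Proof.
move=> a b; have [v <-] := module_quotient_pi_sur x.
by rewrite !module_quotient_piZ -raddfD scalerDl.
Qed.

HB.instance Definition _ := GRing.Zmodule_isLmodule.Build R Q
  module_quotient_scaleA module_quotient_scale1
  module_quotient_scaleDr module_quotient_scaleDl.

Fact module_quotient_pi_scalable : scalable module_quotient_pi.
Proof. by move=> a v; rewrite -module_quotient_piZ. Qed.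

HB.instance Definition _ :=
  GRing.isScalable.Build R V Q *:%R module_quotient_pi module_quotient_pi_scalable.

End QuotientModule.

Section LocalizationMap.
Variables (R : comNzRingType) (q : prime_idealr R).
Local Notation S := (localization q).

Definition loc (r : R) : S :=
  \pi_(Localization.type q) (@Localization.Frac R q (r, 1) (Localization.one_notin q)).

Lemma loc_zmod : zmod_morphism loc.
Proof.
move=> x y; rewrite /loc; set X := Localization.Frac _; set Y := Localization.Frac _ in X *.
rewrite -[RHS]/(Localization.add _ (Localization.opp _)) !piE.
by apply: Localization.eq_frac => /=; ring.
Qed.

Lemma loc_monoid : monoid_morphism loc.
Proof.
split=> [|x y]; first by rewrite -[RHS]/(Localization.one q) piE.
by rewrite -[RHS]/(Localization.mul _ _) !piE; apply: Localization.eq_frac => /=; ring.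
Qed.

HB.instance Definition _ := GRing.isZmodMorphism.Build R S loc loc_zmod.
HB.instance Definition _ := GRing.isMonoidMorphism.Build R S loc loc_monoid.

Lemma loc_eq0 r : loc r = 0 <-> exists2 u, u \notin (q : pred R) & u * r = 0.
Proof.
rewrite -[0]/(Localization.zero q) /loc piE; split.
  by move=> /eqmodP/Localization.eqfP[u uq]; rewrite /= mulr1 mul0r subr0; exists u.
move=> [u uq ur0]; apply/eqmodP/Localization.eqfP; exists u => //=.
by rewrite mulr1 mul0r subr0.
Qed.

Lemma loc_unit w : w \notin (q : pred R) -> exists s, s * loc w = 1.
Proof.
move=> wq; exists (\pi_(Localization.type q) (@Localization.Frac R q (1, w) wq)).
rewrite -[RHS]/(Localization.one q) -[LHS]/(Localization.mul _ _) !piE.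
by apply: Localization.eq_frac => /=; ring.
Qed.

Lemma loc_frac (x : S) :
  exists2 w, w \notin (q : pred R) & exists r, loc w * x = loc r.
Proof.
elim/quotW: x => x; exists x.2; first exact: Localization.den_notin.
exists x.1; rewrite -[_ * _]/(Localization.mul _ _) !piE.
by apply: Localization.eq_frac => /=; ring.
Qed.

Lemma loc_lreg w (x y : S) : w \notin (q : pred R) -> loc w * x = loc w * y -> x = y.
Proof.
by move=> /loc_unit[s sw] e; rewrite -[x]mul1r -sw -mulrA e mulrA sw mul1r.
Qed.

End LocalizationMap.

(** * Injective modules cut out of Hom_Z(R, D) *)

Section InjectiveOfFunctionals.
Variables (R : comNzRingType) (q : prime_idealr R).
Local Notation S := (localization q).
Variables (E : lmodType S) (D : zmodType).
Variables (lam : {additive E -> D}) (Pi : (R -> D) -> E).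
Hypothesis divD : divisible D.
Hypothesis PiD : forall phi psi, zmod_morphism phi -> zmod_morphism psi ->
  Pi (phi \- psi) = Pi phi - Pi psi.
Hypothesis PiM : forall r phi, zmod_morphism phi ->
  Pi (fun x => phi (x * r)) = loc q r *: Pi phi.
Hypothesis PiK : forall y, Pi (fun r => lam (loc q r *: y)) = y.

(* lam and Pi make E a direct factor of Hom_Z(R, D), which is injective over R
   because D is divisible; R-linear maps between S-modules are S-linear. *)
Lemma injective_of_functionals : injective_module E.
Proof.
move=> A B i h i_inj.
have [g gP] := divisible_extension (lam \o h) i_inj divD.
pose phi b r := g (loc q r *: b).
have phi_add b : zmod_morphism (phi b).
  by move=> x y; rewrite /phi raddfB scalerBl raddfB.
pose k b := Pi (phi b).
have k_add : zmod_morphism k.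
  move=> b c; rewrite /k -PiD //; congr Pi; apply/funext => r.
  by rewrite /phi scalerBr raddfB.
have kR r b : k (loc q r *: b) = loc q r *: k b.
  rewrite /k -PiM //; congr Pi; apply/funext => x.
  by rewrite /phi scalerA rmorphM.
have kZ : scalable k.
  move=> s b; have [w wq [r wr]] := loc_frac s; have [t tw] := loc_unit wq.
  have e : s = t * loc q r by rewrite -wr mulrA tw mul1r.
  rewrite -[LHS]scale1r -tw -scalerA -kR scalerA wr kR scalerA -e.
  by [].
pose kM := GRing.isZmodMorphism.Build B E k k_add.
pose kS := GRing.isScalable.Build S B E *:%R k kZ.
pose k' : {linear B -> E} := HB.pack k kM kS.
exists k' => a; rewrite -[RHS]PiK; congr Pi; apply/funext => r.
by rewrite /phi -linearZ gP /= linearZ.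
Qed.

End InjectiveOfFunctionals.

(** * An obstruction to finite injective dimension *)

Section KernelModule.
Variables (R : nzRingType) (V W : lmodType R) (phi : {linear V -> W}).

Definition kernel_pred : pred V := fun x => phi x == 0.

Fact kernel_pred_closed : submod_closed kernel_pred.
Proof.
split=> [|a x y /eqP x0 /eqP y0]; first by rewrite unfold_in /kernel_pred raddf0.
by rewrite unfold_in /kernel_pred linearP x0 y0 scaler0 addr0.
Qed.
HB.instance Definition _ := GRing.isSubmodClosed.Build R V kernel_pred kernel_pred_closed.

Record kernel_module := KernelModule {
  kernel_module_val :> V;
  _ : kernel_module_val \in kernel_pred
}.
HB.instance Definition _ := [isSub for kernel_module_val].
HB.instance Definition _ := [Choice of kernel_module by <:].
HB.instance Definition _ := [SubChoice_isSubLmodule of kernel_module by <:].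

End KernelModule.

(** [h] is a function on all of [V], linear on the kernel only: later statements about syzygies then
    need no submodule type. *)
Lemma injective_extend_kernel (R : comNzRingType) (E V W : lmodType R)
    (phi : {linear V -> W}) (h : V -> E) :
  injective_module E ->
  (forall a x y, phi x = 0 -> phi y = 0 -> h (a *: x + y) = a *: h x + h y) ->
  exists k : {linear V -> E}, forall x, phi x = 0 -> k x = h x.
Proof.
move=> injE hlin; pose h1 (x : kernel_module phi) := h (val x).
have h1lin : linear h1.
  move=> a [x /= px] [y /= py]; rewrite /h1 /= hlin //; exact/eqP.
pose hM := GRing.isLinear.Build R (kernel_module phi) E *:%R h1 h1lin.
pose h2 : {linear kernel_module phi -> E} := HB.pack h1 hM.
have [k kP] := injE _ _ (val : {linear kernel_module phi -> V}) h2 val_inj.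
by exists k => x /eqP px; have := kP (KernelModule px).
Qed.

Section InfiniteInjectiveDimension.
Variables (S : comNzRingType) (n : nat) (a : 'I_n -> S) (i0 i1 i2 : 'I_n).
Local Notation V := 'rV[S]_n.

Definition ideal_cover (r : V) : S^o := \sum_i r 0 i * a i.

Fact ideal_cover_linear : linear ideal_cover.
Proof.
move=> s x y; rewrite /ideal_cover scaler_sumr -big_split; apply: eq_bigr => i _.
by rewrite !mxE mulrDl -mulrA.
Qed.
HB.instance Definition _ := GRing.isLinear.Build S V S^o *:%R ideal_cover ideal_cover_linear.

Lemma ideal_cover_delta i : ideal_cover (delta_mx 0 i) = a i.
Proof.
rewrite /ideal_cover (bigD1 i) //= mxE !eqxx mul1r big1 ?addr0 // => j /negPf ji.
by rewrite mxE ji mul0r.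
Qed.

Lemma ideal_cover_pair x y i j :
  ideal_cover (x *: delta_mx 0 i - y *: delta_mx 0 j) = x * a i - y * a j.
Proof. by rewrite linearP /= -scaleNr linearZ /= !ideal_cover_delta -mulNr. Qed.

Hypotheses (i01 : i0 != i1) (i02 : i0 != i2) (i12 : i1 != i2).
(** The intended case is a = (p, zeta_1, ..., zeta_(n-1)) in R_m, with i0, i1, i2 the places 0, 1,
    2: products of generators are divisible by p, and the coordinates of a syzygy at positive places
    lie in the ideal. *)
Hypothesis a0_reg : forall x, a i0 * x = 0 -> x = 0.
Hypothesis aa : forall i j, exists t, a i * a j = a i0 * t.
Hypothesis syz1 : forall r, ideal_cover r = 0 -> exists t, r 0 i1 = ideal_cover t.
Hypothesis syz2 : forall r, ideal_cover r = 0 -> exists t, r 0 i2 = ideal_cover t.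
Hypothesis proper : forall t, ideal_cover t <> 1.

Let a0_inj x y : a i0 * x = a i0 * y -> x = y.
Proof.
by move=> /eqP e; apply/eqP; rewrite -subr_eq0; apply/eqP/a0_reg/eqP;
  rewrite mulrBr subr_eq0.
Qed.

Lemma ideal_cover_mul_div i (t : V) : exists u, ideal_cover t * a i = a i0 * u.
Proof.
have [u uP] := choice (fun j => aa j i).
exists (\sum_j t 0 j * u j); rewrite mulr_suml mulr_sumr; apply: eq_bigr => j _.
by rewrite -mulrA uP mulrCA.
Qed.

(* Every homomorphism from the first syzygy L of the ideal (a) to the kernel of
   delta extends to the free module covering (a); that is, Ext^1((a), ker delta)
   vanishes. *)
Definition syzygy_extension (E E' : lmodType S) (delta : {linear E -> E'}) :=
  forall h : V -> E,
    (forall s x y, ideal_cover x = 0 -> ideal_cover y = 0 ->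
       h (s *: x + y) = s *: h x + h y) ->
    (forall x, ideal_cover x = 0 -> delta (h x) = 0) ->
  exists2 k : {linear V -> E}, forall x, delta (k x) = 0
    & forall x, ideal_cover x = 0 -> k x = h x.

Lemma lift_free (E E' : lmodType S) (delta : {linear E -> E'}) (k : {linear V -> E'}) :
  (forall x, exists y, k x = delta y) ->
  exists g : {linear V -> E}, forall x, delta (g x) = k x.
Proof.
move=> kim; have [y yP] := choice (fun i => kim (delta_mx 0 i)).
pose g (x : V) := \sum_i x 0 i *: y i.
have glin : linear g.
  move=> s x x'; rewrite /g scaler_sumr -big_split; apply: eq_bigr => i _.
  by rewrite !mxE scalerDl scalerA.
pose gM := GRing.isLinear.Build S V E *:%R g glin.
exists (HB.pack_for {linear V -> E} g gM) => x /=; rewrite /g linear_sum.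
rewrite [x in RHS]row_sum_delta linear_sum; apply: eq_bigr => i _.
by rewrite !linearZ yP.
Qed.

(** Dimension shift. An extension [h'] of [h] exists with values in [E], and [delta \o h'] factors
    through a map from the ideal to [ker delta']. The coordinate [r 0 i1] sends syzygies to the
    ideal and has a section [v], so [ext'] applies to the composite and its result, pulled back
    along [v], corrects [h']. *)
Lemma syzygy_extension_step (E E' E'' : lmodType S) (delta : {linear E -> E'})
    (delta' : {linear E' -> E''}) :
  injective_module E -> (forall x, delta' x = 0 <-> exists y, x = delta y) ->
  syzygy_extension delta' -> syzygy_extension delta.
Proof.
move=> injE exact' ext' h hlin hker.
have [h' h'P] := @injective_extend_kernel _ _ _ _ ideal_cover h injE hlin.
have dh' t t' : ideal_cover t = ideal_cover t' -> delta (h' t) = delta (h' t').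
  move=> e; have t0 : ideal_cover (t - t') = 0 by rewrite raddfB /= e subrr.
  by apply/eqP; rewrite -subr_eq0 -!linearB h'P // hker.
(* A preimage of [r 0 i1] in the free module; by [dh'] its choice does not affect
   [delta (h' (c r))]. *)
pose c (r : V) := if pselect (ideal_cover r = 0) is left r0 then projT1 (cid (syz1 r0)) else 0.
have cP r : ideal_cover r = 0 -> r 0 i1 = ideal_cover (c r).
  by rewrite /c; case: pselect => // r0 _; case: (cid _).
have [|x x0|k dk kP] := ext' (fun r => delta (h' (c r))).
- move=> s x y x0 y0; rewrite -linearP -linearP; apply: dh'; rewrite linearP.
  have xy0 : ideal_cover (s *: x + y) = 0 by rewrite linearP /= x0 y0 scaler0 addr0.
  by rewrite /= -!cP // !mxE.
- by apply/(exact' _); exists (h' (c x)).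
have [g gP] := lift_free (fun x => (exact' _).1 (dk x)).
have [u uP] := choice (ideal_cover_mul_div i1).
(* The syzygy with coordinate [ideal_cover t] at [i1]; it depends on [t] only through
   [ideal_cover t], hence vanishes when [t] is a syzygy. *)
pose v t : V := ideal_cover t *: delta_mx 0 i1 - u t *: delta_mx 0 i0.
have v0 t : ideal_cover (v t) = 0.
  by rewrite ideal_cover_pair uP mulrC subrr.
have v1 t : v t 0 i1 = ideal_cover t.
  by rewrite !mxE !eqxx [i1 == i0]eq_sym (negPf i01) !mulr0 subr0 mulr1.
have vlin : linear v.
  move=> s x y; rewrite /v; have -> : u (s *: x + y) = s * u x + u y.
    apply: a0_inj; rewrite mulrDr mulrCA -!uP mulrA -mulrDl.
    by rewrite linearP.
  by rewrite linearP !scalerDl scalerBr !scalerA opprD addrACA.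
pose vM := GRing.isLinear.Build S V V *:%R v vlin.
pose v' : {linear V -> V} := HB.pack v vM.
(* [delta (g (v t))] is [delta (h' (c (v t)))], that is [delta (h' t)], so [delta] kills the
   difference; on syzygies [v] is 0 and [h'] is unchanged. *)
pose k' : {linear V -> E} := h' \- (g \o v').
exists k' => [x|x x0]; rewrite /k' /=.
  rewrite linearB /= (gP (v x)) kP ?v0 //; apply/eqP; rewrite subr_eq0; apply/eqP/dh'.
  by rewrite -cP // v1.
have -> : v x = 0.
  rewrite /v x0 scale0r sub0r (_ : u x = 0) ?scale0r ?oppr0 //.
  by apply: a0_inj; rewrite -uP x0 mul0r mulr0.
by rewrite raddf0 subr0 h'P.
Qed.

Lemma infinite_injective_dimension : ~ finite_injective_dimension (S^o : lmodType S).
Proof.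
move=> [d [E [e [delta [injE e_inj ker0 kerS E0]]]]].
have ext k : syzygy_extension (delta k).
  (* Descending induction on the degree: [m] bounds the number of steps from [k] to a degree greater
     than [d], where the resolution vanishes. *)
  have [m le_dm] : exists m, (d < m + k)%N by exists d.+1; lia.
  elim: m k le_dm => [|m IH] k le_dm.
    move=> h _ _; exists (\0 : {linear V -> E k}) => x; first by rewrite raddf0.
    by move=> _; rewrite [RHS]E0.
  apply: (syzygy_extension_step (injE k) (kerS k)); apply: IH.
  by rewrite addnS -addSn.
(* The homomorphism r |-> r_1 a_2 / a_0 on syzygies, made total by an arbitrary value elsewhere. *)
have div r : exists w, ideal_cover r = 0 -> r 0 i1 * a i2 = a i0 * w.
  have [r0|r0] := pselect (ideal_cover r = 0); last by exists 0.
  have [t ->] := syz1 r0; have [u uP] := ideal_cover_mul_div i2 t.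
  by exists u.
have [w wP] := choice div.
have [|x x0|k dk kP] := ext 0%N (fun r => e (w r)).
- move=> s x y x0 y0; rewrite -linearP; congr (e _); apply: a0_inj.
  have xy0 : ideal_cover (s *: x + y) = 0 by rewrite linearP /= x0 y0 scaler0 addr0.
  rewrite -wP // !mxE mulrDl -mulrA !wP // mulrCA -mulrDr.
  by [].
- by apply/ker0; exists (w x).
have [s sP] := choice (fun i => (ker0 _).1 (dk (delta_mx 0 i))).
(* On this Koszul syzygy the homomorphism takes the value [a i2], so an extension to the free module
   would put [a i2] in the ideal generated by [a i0] and [a i1]. *)
pose r : V := a i0 *: delta_mx 0 i1 - a i1 *: delta_mx 0 i0.
have r0 : ideal_cover r = 0.
  by rewrite ideal_cover_pair mulrC subrr.
have wr : w r = a i2.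
  apply: a0_inj; rewrite -wP // !mxE !eqxx [i1 == i0]eq_sym (negPf i01).
  by rewrite !mulr0 subr0 mulr1.
have e2 : a i2 = a i0 * s i1 - a i1 * s i0.
  apply: e_inj; rewrite -{1}wr -kP // /r raddfB /= !linearZ /= !sP -!linearZ -raddfB.
  by [].
(* That relation is a syzygy with coordinate 1 at [i2], against [syz2] and properness of the
   ideal. *)
pose r' : V := delta_mx 0 i2 + (s i0 *: delta_mx 0 i1 - s i1 *: delta_mx 0 i0).
have r'0 : ideal_cover r' = 0.
  by rewrite raddfD /= ideal_cover_pair ideal_cover_delta e2; ring.
have [t] := syz2 r'0; rewrite !mxE !eqxx ![i2 == _]eq_sym (negPf i02) (negPf i12).
by rewrite !mulr0 subr0 addr0 => /esym/proper.
Qed.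

End InfiniteInjectiveDimension.

(** * The algebra of a form and its duality *)

Section FormAlgebra.
Variables (n : nat) (f : binary_form n).
Hypotheses (n_gt1 : (1 < n)%N) (f0 : f 0 0 != 0).

Local Notation h := ((f 0 0)%:~R^-1 *: dehomogenized f).
Local Notation K := (form_algebra f).
Local Notation inR := (@form_ring_pred n f).
Local Notation th := (theta f).

Let f0Q : (f 0 0)%:~R != 0 :> rat. Proof. by rewrite intr_eq0. Qed.

Lemma dehomogenized_lead :
  size (dehomogenized f) = n.+1 /\ lead_coef (dehomogenized f) = (f 0 0)%:~R.
Proof.
rewrite /dehomogenized big_ord_recl subn0.
set a := _ *: 'X^n; set b := \sum_(_ < _) _.
have sa : size a = n.+1 by rewrite size_scale // size_polyXn.
have sb : (size b < size a)%N.
  rewrite sa ltnS; apply: leq_trans (size_sum _ _ _) _.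
  apply/bigmax_leqP => i _; apply: leq_trans (size_scale_leq _ _) _.
  by rewrite size_polyXn /= /bump /= add1n subnSK // leq_subr.
by rewrite size_polyDl // lead_coefDl // sa lead_coefZ lead_coefXn mulr1.
Qed.

Lemma modulus_monic : mk_monic h = h.
Proof.
have [sz lc] := dehomogenized_lead.
rewrite /mk_monic monicE lead_coefZ size_scale ?invr_eq0 // sz lc.
by rewrite mulVf // eqxx ltnS ltnW.
Qed.

Lemma modulus_is_monic : h \is monic.
Proof. by have := monic_mk_monic h; rewrite modulus_monic. Qed.

Lemma size_modulus : size (mk_monic h) = n.+1.
Proof. by rewrite modulus_monic size_scale ?invr_eq0 // dehomogenized_lead.1. Qed.

Definition class_of (p : {poly rat}) : K := in_qpoly h p.
HB.instance Definition _ := GRing.RMorphism.copy class_of (in_qpoly h).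

Lemma class_of_small (p : {poly rat}) : (size p <= n)%N -> polyn (class_of p) = p.
Proof. by move=> sp; apply: in_qpoly_small; rewrite size_modulus. Qed.

Lemma class_of_polyn (x : K) : class_of (polyn x) = x.
Proof. by apply/val_inj; exact: in_qpoly_small (size_mk_monic x). Qed.

Lemma size_polyn (x : K) : (size (polyn x) <= n)%N.
Proof. by rewrite -ltnS; apply: (leq_trans (size_mk_monic x)); rewrite size_modulus. Qed.

Lemma class_ofX : class_of 'X = th. Proof. by []. Qed.

Lemma class_of_dehomogenized : class_of (dehomogenized f) = 0.
Proof.
apply/val_inj => /=; rewrite modulus_monic.
have {1}-> : dehomogenized f = (f 0 0)%:~R *: h by rewrite scalerA divff ?scale1r.
rewrite Pdiv.RingMonic.rmodpZ ?modulus_is_monic //.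
by rewrite Pdiv.RingMonic.rmodpp ?modulus_is_monic // scaler0.
Qed.

Definition cst (c : rat) : K := class_of c%:P.
HB.instance Definition _ := GRing.RMorphism.copy cst (class_of \o polyC).

Lemma cst_mul c (x : K) : polyn (cst c * x) = c *: polyn x.
Proof.
rewrite -[x in LHS]class_of_polyn -[cst c]/(class_of c%:P) -rmorphM mul_polyC.
rewrite class_of_small //.
by apply: leq_trans (size_scale_leq _ _) _; exact: size_polyn.
Qed.

(** In the basis zeta only zeta_(n-1) involves theta^(n-1), with coefficient f_0. *)
Definition tau (x : K) : rat := (polyn x)`_n.-1 / (f 0 0)%:~R.

Fact tau_zmod : zmod_morphism tau.
Proof. by move=> x y; rewrite /tau coefB mulrBl. Qed.
HB.instance Definition _ := GRing.isZmodMorphism.Build K rat tau tau_zmod.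

Lemma tau_cst c x : tau (cst c * x) = c * tau x.
Proof. by rewrite /tau cst_mul coefZ mulrA. Qed.

Lemma theta_exp i : (i < n)%N -> polyn (th ^+ i) = 'X^i.
Proof.
by move=> lt_in; rewrite -class_ofX -rmorphXn class_of_small ?size_polyXn.
Qed.

Lemma tau_theta i : (i < n.-1)%N -> tau (th ^+ i) = 0.
Proof.
move=> lt_in; rewrite /tau theta_exp; last by lia.
by rewrite coefXn gtn_eqF ?mul0r.
Qed.

Lemma tau_theta_top : tau (th ^+ n.-1) * (f 0 0)%:~R = 1.
Proof. by rewrite /tau theta_exp ?coefXn ?eqxx ?mul1r ?mulVf //; lia. Qed.

(** A power of theta moves the leading term of a nonzero [x] to degree n - 1 without any reduction
    modulo the form. *)
Lemma tau_nondegenerate x : (forall y, tau (x * y) = 0) -> x = 0.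
Proof.
move=> x0; apply/val_inj/eqP; rewrite -size_poly_leq0 leqNgt; apply/negP => sx.
have sn := size_polyn x; have := x0 (th ^+ (n - size (polyn x))).
rewrite -[x in tau (x * _)]class_of_polyn -class_ofX -rmorphXn -rmorphM /tau.
have arith s : (0 < s)%N -> (s <= n)%N ->
  [/\ ((s + (n - s).+1).-1 <= n)%N, (n.-1 < n - s)%N = false
    & (n.-1 - (n - s) = s.-1)%N] by move=> *; split; lia.
have [small ge_ns sub] := arith _ sx sn.
rewrite class_of_small; last first.
  by apply: leq_trans (size_polyMleq _ _) _; rewrite size_polyXn.
rewrite coefMXn ge_ns sub.
move/eqP; rewrite mulf_eq0 invr_eq0 (negPf f0Q) orbF -lead_coefE lead_coef_eq0.
by rewrite -size_poly_eq0 => /eqP s0; rewrite s0 in sx.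
Qed.

(* zeta_k for 0 < k < n; the formula gives 0 for k = 0 and - f_n for k = n. *)
Definition zsum (k : nat) : K := \sum_(j < k) th ^+ (k - j) *~ f 0 (inord j).

Lemma zsum0 : zsum 0 = 0. Proof. exact: big_ord0. Qed.

Lemma zsumS k : zsum k.+1 = th * (zsum k + (f 0 (inord k))%:~R).
Proof.
rewrite /zsum big_ord_recr /= subSnn expr1 mulrDr mulr_sumr mulrzr.
congr (_ + _); apply: eq_bigr => j _.
by rewrite mulrzAr -exprS subSn // ltnW.
Qed.

Lemma zeta_zsum k : (0 < k)%N -> zeta f k = zsum k.
Proof. by case: k. Qed.

Lemma zsum_last : zsum n = (- f 0 ord_max)%:~R.
Proof.
have root : \sum_(j < n.+1) th ^+ (n - j) *~ f 0 j = 0.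
  rewrite -[RHS]class_of_dehomogenized /dehomogenized raddf_sum; apply: eq_bigr => i _.
  by rewrite scaler_int raddfMz /= rmorphXn.
move: root; rewrite big_ord_recr /= subnn expr0 mulrNz => /eqP.
rewrite addr_eq0 => /eqP <-; apply: eq_bigr => j _.
by congr (_ *~ f 0 _); apply/val_inj; rewrite /= inordK // ltnS ltnW.
Qed.

Lemma theta_zsumS i k :
  th ^+ i * zsum k.+1 = th ^+ i.+1 * zsum k + th ^+ i.+1 *~ f 0 (inord k).
Proof. by rewrite zsumS mulrA -exprSr mulrDr mulrzr. Qed.

(** The recursion for [zsum] trades k for an exponent of theta, up to a multiple of a power on which
    [tau] vanishes. For i + k <= n - 1 it is followed down to zsum 1 = f_0 theta, for i + k > n - 1
    up to zsum n = - f_n, an integer. *)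
Lemma tau_theta_zsum i k : (i < n.-1)%N -> (0 < k <= n)%N ->
  tau (th ^+ i * zsum k) = ((i + k)%N == n.-1)%:R.
Proof.
have up : forall k i, (0 < k)%N -> (i + k <= n.-1)%N ->
    tau (th ^+ i * zsum k) = ((i + k)%N == n.-1)%:R.
  elim=> [//|[_|{}k IH]] {}i _ le_ik; rewrite theta_zsumS raddfD raddfMz /=.
    rewrite zsum0 mulr0 raddf0 add0r addn1; move: le_ik; rewrite addn1.
    have -> : inord 0 = 0 :> 'I_n.+1 by apply/val_inj; rewrite /= inordK.
    rewrite leq_eqVlt => /orP[/eqP e|lt_in]; last by rewrite tau_theta // mul0rz ltn_eqF.
    by rewrite e eqxx -mulrzr tau_theta_top.
  by rewrite IH // ?tau_theta ?mul0rz ?addr0 ?addSn ?addnS //;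
    move: le_ik; rewrite ?addnS; lia.
have down : forall m i, (i < n.-1)%N -> (m <= i)%N -> (m <= n)%N ->
    tau (th ^+ i * zsum (n - m)) = 0.
  elim=> [|m IH] {}i lt_in le_mi le_mn.
    by rewrite subn0 zsum_last mulrzr raddfMz /= tau_theta ?mul0rz.
  case: i lt_in le_mi => // i lt_in le_mi; have := IH i.
  rewrite -subnSK // theta_zsumS raddfD raddfMz /= (tau_theta lt_in) mul0rz addr0.
  by apply=> //; lia.
move=> lt_in /andP[k_gt0 le_kn]; case: (leqP (i + k)%N n.-1) => [|lt_nik]; first exact: up.
rewrite gtn_eqF // -{1}(subKn le_kn); apply: down => //; lia.
Qed.

Definition zeta_dual (k : nat) : K :=
  if k is 0 then zsum n.-1 + (f 0 (inord n.-1))%:~R else th ^+ (n.-1 - k).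

Lemma tau_zeta_dual j k : (j < n)%N -> (k < n)%N ->
  tau (zeta f j * zeta_dual k) = (j == k)%:R.
Proof.
(* Each zeta_j with j > 0 is a multiple of theta, so its product with [zeta_dual 0] is an integer
   times an element of lower index. *)
have thy : th * zeta_dual 0 = (- f 0 ord_max)%:~R.
  by rewrite /zeta_dual -zsumS prednK ?zsum_last // ltnW.
have tau1 m : tau m%:~R = 0.
  by rewrite -[m%:~R]/(1 *~ m) raddfMz /= -(expr0 th) tau_theta ?mul0rz //; lia.
have tz i : (0 < i <= n)%N -> tau (zsum i) = (i == n.-1)%:R.
  by move=> ?; rewrite -[zsum i]mul1r -(expr0 th) tau_theta_zsum ?add0n //; lia.
case: j k => [|j] [|k] lt_jn lt_kn.
- by rewrite mul1r /zeta_dual raddfD /= tau1 addr0 tz ?eqxx //; lia.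
- by rewrite mul1r /zeta_dual tau_theta //; lia.
- rewrite zeta_zsum // zsumS mulrAC thy mulrC mulrzr raddfMz raddfD /= tau1 addr0.
  case: j lt_jn => [|j] lt_jn; first by rewrite zsum0 raddf0 mul0rz.
  by rewrite tz ?ltn_eqF ?mul0rz //; lia.
- rewrite zeta_zsum // mulrC /zeta_dual tau_theta_zsum //; try lia.
  by congr (nat_of_bool _)%:R; rewrite eqSS; apply/eqP/eqP; lia.
Qed.

Lemma zeta_mem k : (k < n)%N -> inR (zeta f k).
Proof. by move=> lt_kn; apply: zeta_in_span; rewrite prednK // ltnW. Qed.

Lemma zsum_mem k : (k <= n)%N -> inR (zsum k).
Proof.
rewrite leq_eqVlt => /orP[/eqP ->|lt_kn].
  by rewrite zsum_last; apply: spanZ; exact: span1.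
case: k lt_kn => [|k] lt_kn; first by rewrite zsum0; exact: span0.
by rewrite -zeta_zsum //; exact: zeta_mem.
Qed.

Lemma multiple_in_span (x : K) : exists2 m, (0 < m)%N & inR (x *+ m).
Proof.
pose P (y : K) := exists2 m : int, m != 0 & inR (y *~ m).
suff [m m0 hm] : P x.
  exists `|m|%N; first by rewrite absz_gt0.
  by rewrite pmulrn abszEsg mulrC mulrzA; exact: spanZ.
have PD y z : P y -> P z -> P (y + z).
  move=> [m m0 hy] [k k0 hz]; exists (m * k); first by rewrite mulf_neq0.
  by rewrite mulrzDl; apply: spanD; [rewrite mulrzA | rewrite mulrC mulrzA]; exact: spanZ.
have Pc c y : P y -> P (cst c * y).
  move=> [m m0 hy]; exists (m * denq c); first by rewrite mulf_neq0 ?denq_neq0.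
  have -> : (cst c * y) *~ (m * denq c) = (y *~ m) *~ numq c.
    have cE : c *~ denq c = (numq c)%:~R by rewrite -mulrzr -numqE.
    by rewrite mulrzA -mulrzAr -mulrzAl -raddfMz /= cE rmorph_int mulrC mulrzr.
  exact: spanZ.
(* f_0 theta = zeta_1 lies in the ring, hence so does f_0^i theta^i. *)
have Pth i : P (th ^+ i).
  have sub := form_ring_subring f.
  have z1 : zsum 1 = th *~ f 0 0.
    rewrite zsumS zsum0 add0r mulrzr; congr (_ *~ f 0 _).
    by apply/val_inj; rewrite /= inordK.
  exists (f 0 0 ^+ i); first by rewrite expf_neq0.
  have -> : th ^+ i *~ f 0 0 ^+ i = (th *~ f 0 0) ^+ i.
    by rewrite -mulrzr rmorphXn -exprMn mulrzr.
  elim: i => [|i IH]; first exact: span1.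
  rewrite exprS; have [_ _ M] := sub; apply: M => //; rewrite -z1; apply: zsum_mem.
  exact: ltnW.
rewrite -[x]class_of_polyn -[polyn x]coefK poly_def raddf_sum.
elim/big_ind: _ => [|y z|i _]; [|exact: PD|].
  by exists 1 => //; rewrite mul0rz; exact: span0.
by rewrite -mul_polyC /= rmorphM rmorphXn; apply: Pc; exact: Pth.
Qed.

Lemma zeta_nondegenerate x : (forall k, (k < n)%N -> tau (x * zeta f k) = 0) -> x = 0.
Proof.
move=> x0; apply: tau_nondegenerate => y.
have [m m_gt0 /asboolP[c yc]] := multiple_in_span y.
have : tau (x * y) *+ m = 0.
  rewrite -raddfMn -mulrnAr yc mulr_sumr raddf_sum big1 //= => k _.
  by rewrite mulrzAr raddfMz /= x0 ?mul0rz //; have := ltn_ord k; lia.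
by move/eqP; rewrite mulrn_eq0 eqn0Ngt m_gt0 => /eqP.
Qed.

Lemma zeta_dual_expansion x (c : nat -> rat) :
  (forall k, (k < n)%N -> tau (x * zeta f k) = c k) ->
  x = \sum_(k < n) cst (c k) * zeta_dual k.
Proof.
move=> xc; apply/eqP; rewrite -subr_eq0; apply/eqP/zeta_nondegenerate => j lt_jn.
rewrite mulrBl raddfB /= xc // mulr_suml raddf_sum (bigD1 (Ordinal lt_jn)) //=.
rewrite big1 => [|k kj]; rewrite -mulrA tau_cst mulrC [_ * zeta _ _]mulrC tau_zeta_dual //.
  by rewrite eqxx mul1r addr0 subrr.
by move: kj; rewrite -val_eqE eq_sym => /negPf /= ->; rewrite mul0r.
Qed.

(** Descending chain condition in K. The ideal generated by [w] is that of its gcd with the modulus,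
    so a gcd of greatest degree gives a [w] whose ideal no further factor from [P] can shrink;
    Bezout then recovers [w] from [x * w]. *)
Lemma stable_power (P : K -> Prop) (x0 : K) : P x0 ->
  (forall x y, P x -> P y -> P (x * y)) ->
  exists2 w, P w & forall x, P x -> exists z, z * (x * w) = w.
Proof.
move=> Px0 PM; pose g (x : K) := gcdp (polyn x) h.
have h_neq0 : h != 0 by rewrite -modulus_monic mk_monic_neq0.
have exm : exists m, `[< exists2 x, P x & (size h - size (g x))%N = m >].
  by exists (size h - size (g x0))%N; apply/asboolP; exists x0.
case: (ex_minnP exm) => _ /asboolP[w Pw <-] minw; exists w => // x Px.
have sle y : (size (g y) <= size h)%N by apply: dvdp_leq => //; exact: dvdp_gcdr.
have dvdM : g w %| g (x * w).
  rewrite dvdp_gcd dvdp_gcdr andbT.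
  have e : polyn (x * w) = Pdiv.CommonRing.rmodp (polyn x * polyn w) h.
    by rewrite [LHS]poly_of_qpolyM [X in Pdiv.CommonRing.rmodp _ X]modulus_monic.
  have := Pdiv.RingMonic.rdivp_eq modulus_is_monic (polyn x * polyn w).
  rewrite -e => /eqP; rewrite addrC -subr_eq => /eqP <-.
  by rewrite dvdp_sub ?dvdp_mull ?dvdp_gcdl ?dvdp_gcdr.
have eqg : g w %= g (x * w).
  rewrite -(dvdp_size_eqp dvdM) eqn_leq dvdp_leq ?gcdp_eq0 ?(negPf h_neq0) ?andbF //=.
  have arith a b c : (b <= a)%N -> (c <= a)%N -> (a - b <= a - c)%N -> (c <= b)%N by lia.
  apply: arith (sle w) (sle (x * w)) _; apply: minw; apply: asboolT.
  by exists (x * w) => //; exact: PM.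
have [[u v] /= uvP] := Bezoutp (polyn (x * w)) h.
have : u * polyn (x * w) + v * h %| polyn w.
  by rewrite (eqp_dvdl _ uvP) -(eqp_dvdl _ eqg) dvdp_gcdl.
move=> /dvdpP[t tP]; exists (class_of (t * u)).
have h0 : class_of h = 0.
  by rewrite -mul_polyC rmorphM /= class_of_dehomogenized mulr0.
rewrite -[RHS]class_of_polyn tP -[x * w in LHS]class_of_polyn -rmorphM mulrDr !mulrA.
by rewrite [RHS]rmorphD /= [class_of (t * v * _)]rmorphM /= h0 mulr0 addr0.
Qed.

End FormAlgebra.

(** * An injective resolution from a dualizing functional *)

Definition rat_int : pred rat := fun x => x \is a Num.int.

Fact rat_int_closed : zmod_closed rat_int.
Proof. by split=> [|x y hx hy]; [exact: rpred0 | exact: rpredB]. Qed.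
HB.instance Definition _ := GRing.isZmodClosed.Build rat rat_int rat_int_closed.

Definition rat_ints : zmodClosed rat := GRing.ZmodClosed.clone rat rat_int _.

Definition rat_mod_int : zmodType := Quotient.quot rat_ints.

Definition mod_int (x : rat) : rat_mod_int := \pi_(Quotient.quot rat_ints) x.

Fact mod_int_zmod : zmod_morphism mod_int.
Proof. exact: (raddfB (\pi_(Quotient.quot rat_ints))). Qed.
HB.instance Definition _ :=
  GRing.isZmodMorphism.Build rat rat_mod_int mod_int mod_int_zmod.

Lemma mod_int_eq0 x : mod_int x = 0 <-> x \is a Num.int.
Proof.
have e : (x - 0 \in rat_int) = (mod_int x == mod_int 0) := Quotient.idealrBE _ x 0.
rewrite subr0 raddf0 in e; rewrite -[_ \is a _]/(x \in rat_int) e.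
by split=> [->|/eqP].
Qed.

Lemma mod_int_sur y : exists x, mod_int x = y.
Proof. by exists (repr (y : Quotient.quot rat_ints)); rewrite /mod_int reprK. Qed.

Lemma divisible_rat : divisible rat.
Proof.
move=> x m m_gt0; exists (x / m%:R).
by rewrite -[_ *+ m]mulr_natr mulfVK // pnatr_eq0 -lt0n.
Qed.

Lemma divisible_rat_mod_int : divisible rat_mod_int.
Proof.
move=> y m m_gt0; have [x <-] := mod_int_sur y.
by have [z <-] := divisible_rat x m_gt0; exists (mod_int z); rewrite raddfMn.
Qed.

Section Resolution.
Variables (R K : comNzRingType) (j : {rmorphism R -> K}) (q : prime_idealr R).
Local Notation S := (localization q).
Local Notation W := (fun w => w \notin (q : pred R)).

(** The hypotheses make [e] K the localization of K at q: elements outside q become invertible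
    there, and whatever [e] kills is killed by the single denominator [w0]. *)
Variables (e : K) (w0 : R).
Hypothesis j_inj : injective j.
Hypothesis ee : e * e = e.
Hypothesis w0W : W w0.
Hypothesis e_ker : forall x, e * x = 0 -> j w0 * x = 0.
Hypothesis e_inv : forall w, W w -> exists2 t, e * t = t & t * j w = e.

Lemma W_lreg w x y : W w -> e * x = x -> e * y = y -> j w * x = j w * y -> x = y.
Proof.
by move=> /e_inv[t _ tw] ex ey E; rewrite -ex -ey -tw -!mulrA E.
Qed.

Lemma WM w w' : W w -> W w' -> W (w * w').
Proof. exact: Localization.mul_notin. Qed.

(** The canonical map from R_q to [e] K. Its value is characterized by all fractions representing
    [s] at once, so that choosing it is harmless. *)
Lemma ev_exists (s : S) : exists t, e * t = t /\
  forall w r, W w -> loc q w * s = loc q r -> j w * t = e * j r.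
Proof.
have [w wW [r wr]] := loc_frac s; have [t et tw] := e_inv wW.
exists (t * j r); split=> [|w' r' w'W wr']; first by rewrite mulrA et.
have /loc_eq0[u uW u0] : loc q (w' * r - w * r') = 0.
  by rewrite rmorphB !rmorphM /= -wr -wr' mulrCA subrr.
have E : e * j (w' * r) = e * j (w * r').
  apply/eqP; rewrite -subr_eq0 -mulrBr -rmorphB; have [v _ <-] := e_inv uW.
  by rewrite -mulrA -rmorphM u0 rmorph0 mulr0.
apply: (W_lreg wW); first by rewrite mulrCA [e * _]mulrA et.
  by rewrite mulrA ee.
transitivity (e * j (w' * r)); first by rewrite -tw rmorphM; ring.
by rewrite E rmorphM; ring.
Qed.

Definition ev (s : S) : K := projT1 (cid (ev_exists s)).

Lemma ev_fix s : e * ev s = ev s.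
Proof. by rewrite /ev; case: cid => t []. Qed.

Lemma evE s w r : W w -> loc q w * s = loc q r -> j w * ev s = e * j r.
Proof. by rewrite /ev; case: cid => t /= [_]; exact. Qed.

Lemma ev_unique s w r t : W w -> loc q w * s = loc q r ->
  e * t = t -> j w * t = e * j r -> t = ev s.
Proof.
by move=> wW ws et wt; apply: (W_lreg wW) => //; rewrite ?ev_fix // (evE wW ws).
Qed.

Lemma ev_loc r : ev (loc q r) = e * j r.
Proof.
apply/esym/(ev_unique (w := 1) (r := r)); rewrite ?rmorph1 ?mul1r ?mulrA ?ee //.
exact: Localization.one_notin.
Qed.

Lemma ev_zmod : zmod_morphism ev.
Proof.
move=> x y; have [v vW [r vr]] := loc_frac x; have [w wW [r' wr]] := loc_frac y.
apply/esym/(ev_unique (w := v * w) (r := w * r - v * r')).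
- exact: WM.
- by rewrite rmorphB !rmorphM /= -vr -wr; ring.
- by rewrite mulrBr !ev_fix.
- rewrite rmorphM rmorphB !rmorphM mulrBr [RHS]mulrBr [in X in _ = X - _]mulrCA.
  rewrite -(evE vW vr) [in X in _ = _ - X]mulrCA -(evE wW wr).
  by ring.
Qed.
HB.instance Definition _ := GRing.isZmodMorphism.Build S K ev ev_zmod.

Lemma evM x y : ev (x * y) = ev x * ev y.
Proof.
have [v vW [r vr]] := loc_frac x; have [w wW [r' wr]] := loc_frac y.
apply/esym/(ev_unique (w := v * w) (r := r * r')).
- exact: WM.
- by rewrite !rmorphM /= -vr -wr; ring.
- by rewrite mulrA ev_fix.
- rewrite !rmorphM mulrACA (evE vW vr) (evE wW wr) mulrACA ee.
  by [].
Qed.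

Lemma ev1 : ev 1 = e.
Proof. by rewrite -(rmorph1 (loc q)) ev_loc rmorph1 mulr1. Qed.

Lemma ev_inj : injective ev.
Proof.
move=> x y /eqP; rewrite -subr_eq0 -raddfB /= => /eqP.
move=> exy; apply/eqP; rewrite -subr_eq0; move: (x - y) exy => s s0.
have [w wW [r wr]] := loc_frac s.
have /e_ker : e * j r = 0 by rewrite -(evE wW wr) s0 mulr0.
rewrite -rmorphM -(rmorph0 j) => /j_inj r0.
apply/eqP/(loc_lreg wW); rewrite wr mulr0; apply/loc_eq0.
by exists w0.
Qed.

Lemma ev_unit w : W w -> exists s, ev s * j w = e.
Proof.
move=> wW; have [s sw] := loc_unit wW; exists s.
by rewrite -[RHS]ev1 -sw evM ev_loc mulrA [_ * e]mulrC ev_fix.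
Qed.

Definition fixed_pred : pred K := fun x => e * x == x.

Fact fixed_pred_closed : zmod_closed fixed_pred.
Proof.
split=> [|x y /eqP xe /eqP ye]; first by rewrite unfold_in /fixed_pred mulr0.
by rewrite unfold_in /fixed_pred mulrBr xe ye.
Qed.
HB.instance Definition _ := GRing.isZmodClosed.Build K fixed_pred fixed_pred_closed.

Record local_algebra := LocalAlgebra {
  local_algebra_val :> K;
  _ : local_algebra_val \in fixed_pred
}.
HB.instance Definition _ := [isSub for local_algebra_val].
HB.instance Definition _ := [Choice of local_algebra by <:].
HB.instance Definition _ := [SubChoice_isSubZmodule of local_algebra by <:].

Lemma val_local_algebra (x : local_algebra) : e * val x = val x.
Proof. by case: x => x /= /eqP. Qed.

Fact local_scale_subproof (s : S) (x : local_algebra) : ev s * val x \in fixed_pred.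
Proof. by rewrite unfold_in /fixed_pred mulrA ev_fix. Qed.
Definition local_scale s x := LocalAlgebra (local_scale_subproof s x).

Fact local_scaleA s t x : local_scale s (local_scale t x) = local_scale (s * t) x.
Proof. by apply/val_inj; rewrite /= evM mulrA. Qed.
Fact local_scale1 : left_id 1 local_scale.
Proof. by move=> x; apply/val_inj; rewrite /= ev1 val_local_algebra. Qed.
Fact local_scaleDr : right_distributive local_scale +%R.
Proof. by move=> s x y; apply/val_inj; rewrite /= mulrDr. Qed.
Fact local_scaleDl x : {morph local_scale^~ x : s t / s + t}.
Proof. by move=> s t; apply/val_inj; rewrite /= raddfD mulrDl. Qed.
HB.instance Definition _ := GRing.Zmodule_isLmodule.Build S local_algebra
  local_scaleA local_scale1 local_scaleDr local_scaleDl.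

Fact local_part_subproof (x : K) : e * x \in fixed_pred.
Proof. by rewrite unfold_in /fixed_pred mulrA ee. Qed.
Definition local_part x := LocalAlgebra (local_part_subproof x).

Lemma local_part_val (x : local_algebra) : local_part (val x) = x.
Proof. by apply/val_inj; rewrite /= val_local_algebra. Qed.

Lemma local_part_zmod : zmod_morphism local_part.
Proof. by move=> x y; apply/val_inj; rewrite /= mulrBr. Qed.
HB.instance Definition _ :=
  GRing.isZmodMorphism.Build K local_algebra local_part local_part_zmod.

Lemma local_partM r x : local_part (j r * x) = loc q r *: local_part x.
Proof. by apply/val_inj; rewrite /= ev_loc; ring: ee. Qed.

Definition ev_module (s : S^o) : local_algebra := local_part (ev s).

Fact ev_module_linear : linear ev_module.
Proof.
move=> s x y; apply/val_inj; rewrite /= raddfD /= mulrDr.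
by rewrite !ev_fix -[s *: x]/(s * x) evM.
Qed.
HB.instance Definition _ :=
  GRing.isLinear.Build S S^o local_algebra *:%R ev_module ev_module_linear.

Lemma ev_module_inj : injective ev_module.
Proof. by move=> x y /(congr1 val) /=; rewrite !ev_fix => /ev_inj. Qed.


Variable tau : {additive K -> rat}.
Hypothesis tau_nd : forall x, (forall r, tau (j r * x) = 0) -> x = 0.
Hypothesis tau_rep : forall phi : R -> rat, zmod_morphism phi ->
  exists x, forall r, phi r = tau (j r * x).
Hypothesis tau_rep_mod : forall phi : R -> rat_mod_int, zmod_morphism phi ->
  exists x, forall r, phi r = mod_int (tau (j r * x)).

(** Through [tau], K represents Hom_Z(R, Q), and [e] K is a direct factor of K. *)
Lemma local_algebra_injective : injective_module local_algebra.
Proof.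
have ex phi : exists x, zmod_morphism phi -> forall r, phi r = tau (j r * x).
  have [/tau_rep[x xP]|no] := pselect (zmod_morphism phi); first by exists x.
  by exists 0 => /no.
have [X XP] := choice ex; pose Pi phi := local_part (X phi).
have PiE phi x : zmod_morphism phi -> (forall r, phi r = tau (j r * x)) ->
    Pi phi = local_part x.
  move=> phi_add xP; congr local_part; apply/eqP; rewrite -subr_eq0; apply/eqP.
  by apply: tau_nd => r; rewrite mulrBr raddfB /= -XP // -xP subrr.
apply: (injective_of_functionals (lam := tau \o (val : local_algebra -> K)) (Pi := Pi)
  divisible_rat) => [phi psi phiD psiD|r phi phiD|y].
- rewrite -raddfB; apply: PiE => [x z|r].
    by rewrite /= phiD psiD !opprD addrACA.
  by rewrite mulrBr raddfB /= -!XP.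
- rewrite -local_partM; apply: PiE => [x z|x]; first by rewrite mulrBl phiD.
  by rewrite mulrA -rmorphM; exact: XP.
- rewrite -[RHS]local_part_val; apply: PiE => [x z|r] /=.
    by rewrite rmorphB /= raddfB /= mulrBl raddfB.
  by rewrite ev_loc -mulrA mulrCA val_local_algebra.
Qed.

Definition dual (x : K) : Prop := forall r, tau (j r * x) \is a Num.int.

Lemma dualB x y : dual x -> dual y -> dual (x - y).
Proof. by move=> hx hy r; rewrite mulrBr raddfB rpredB. Qed.

Lemma dualM r x : dual x -> dual (j r * x).
Proof. by move=> hx s; rewrite mulrA -rmorphM. Qed.

(** [c] and [d] are mutually inverse in [e] K, and the dual lattice becomes [c] R_q after
    localization. [W_stable] is a chain condition modulo m: some ideal generated by a [w] outside q
    cannot be shrunk there by further denominators. *)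
Variables (c d : K).
Hypothesis cde : c * d * e = e.
Hypothesis dual_c : dual c.
Hypothesis dual_frac : forall x, dual x ->
  exists w r, W w /\ j w * (e * (d * x)) = e * j r.
Hypothesis dual_tor : forall x, exists2 m, (0 < m)%N & dual (x *+ m).
Hypothesis W_stable : forall m, (0 < m)%N -> exists2 w, W w &
  forall w', W w' -> exists r y, r * w' * w - w = y *+ m.

Lemma dual_ev x : dual x -> exists s, e * (d * x) = ev s.
Proof.
move=> /dual_frac[w [r [wW wr]]]; have [t tw] := loc_unit wW.
exists (t * loc q r); apply: (ev_unique wW _ _ wr); last by rewrite mulrA ee.
by rewrite mulrA [_ * t]mulrC tw mul1r.
Qed.

(** * The quotient K_q / R_q and its primary representatives *)

Definition ev_image : pred local_algebra := fun v => `[< exists s, v = ev_module s >].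

Fact ev_image_closed : zmod_closed ev_image.
Proof.
split=> [|x y /asboolP[s ->] /asboolP[t ->]]; apply/asboolP.
  by exists 0; rewrite raddf0.
by exists (s - t); rewrite raddfB.
Qed.
HB.instance Definition _ :=
  GRing.isZmodClosed.Build local_algebra ev_image ev_image_closed.

Definition ev_images : zmodClosed local_algebra :=
  GRing.ZmodClosed.clone local_algebra ev_image _.

Fact ev_imageZ (s : S) v : v \in ev_images -> s *: v \in ev_images.
Proof.
by move=> /asboolP[t ->]; apply/asboolP; exists (s *: t); rewrite linearZ.
Qed.

Local Notation E1 := (module_quotient ev_imageZ).
Local Notation pi1 := (module_quotient_pi ev_imageZ).

(* x represents an element of the q-primary part of K modulo the dual lattice. *)
Definition primary (x : K) : Prop :=
  forall w, W w -> exists r, dual (j r * j w * x - x).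

Lemma primaryB x y : primary x -> primary y -> primary (x - y).
Proof.
move=> px py w wW; have [r rx] := px w wW; have [s sy] := py w wW.
(* Chosen so that 1 - (r + s - r s w) w = (1 - r w) (1 - s w). *)
exists (r + s - r * s * w).
have -> : j (r + s - r * s * w) * j w * (x - y) - (x - y)
    = j (1 - s * w) * (j r * j w * x - x) - j (1 - r * w) * (j s * j w * y - y).
  by rewrite !rmorphB rmorphD !rmorphM rmorph1; ring.
by apply: dualB; exact: dualM.
Qed.

Lemma primaryM r x : primary x -> primary (j r * x).
Proof.
move=> px w wW; have [s sx] := px w wW; exists s.
have -> : j s * j w * (j r * x) - j r * x = j r * (j s * j w * x - x) by ring.
exact: dualM.
Qed.

(** Modulo [m], the element [r * w] is the idempotent that projects R/m onto its localization at q.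
    Multiplying [x0] by it keeps the q-part, and the class is unchanged because
    [w * (r * w * x0 - x0)] is in the dual lattice and [w] is invertible in R_q. *)
Lemma primary_exists (y : E1) : exists2 x, primary x & pi1 (local_part (d * x)) = y.
Proof.
have [v <-] := module_quotient_pi_sur y; pose x0 := c * val v.
have [m m_gt0 mx0] := dual_tor x0; have [w wW wP] := W_stable m_gt0.
have [r [z rz]] := wP w wW; exists (j r * j w * x0).
  move=> w' w'W; have [r' [z' rz']] := wP w' w'W; exists r'.
  have -> : j r' * j w' * (j r * j w * x0) - j r * j w * x0
      = j r * j (r' * w' * w - w) * x0 by rewrite rmorphB !rmorphM; ring.
  by rewrite rz' rmorphMn mulrnAr mulrnAl -mulrnAr -rmorphM; exact: dualM.
apply/module_quotient_piP; apply/asboolP.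
have v0 : val v = e * (d * x0).
  by rewrite /x0 -[LHS]val_local_algebra -{1}cde; ring.
have [s1 s1P] : exists s, e * (d * (j w * (j r * j w * x0 - x0))) = ev s.
  apply: dual_ev; have -> : j w * (j r * j w * x0 - x0) = j (r * w * w - w) * x0.
    by rewrite rmorphB !rmorphM; ring.
  by rewrite rz rmorphMn mulrnAl -mulrnAr; exact: dualM.
have [t tP] := ev_unit wW; exists (t * s1); apply/val_inj => /=.
rewrite ev_fix evM -s1P v0 -mulrBr -mulrBr.
rewrite -[in LHS]tP -[in RHS](ev_fix t).
transitivity (e * ev t * (d * (j w * (j r * j w * x0 - x0)))); ring: (ev_fix t).
Qed.

(** Some denominator [w0 * w] brings [x] into the dual lattice, and a primary [x] is congruent to a
    multiple of [w0 * w * x]. *)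
Lemma primary_unique x : primary x -> pi1 (local_part (d * x)) = 0 -> dual x.
Proof.
move=> px; rewrite -[0](raddf0 pi1) => /module_quotient_piP.
rewrite subr0 => /asboolP[s /(congr1 val)/=]; rewrite ev_fix => xs.
have [w wW [r wr]] := loc_frac s.
have E : e * (j w * x - c * j r) = 0.
  rewrite mulrBr -{1}cde; have := evE wW wr; rewrite -xs => E.
  have -> : c * d * e * (j w * x) = c * (j w * (e * (d * x))) by ring.
  by rewrite E; ring.
have /eqP := e_ker E; rewrite mulrBr subr_eq0 => /eqP E'.
have [r' r'x] := px (w0 * w) (WM w0W wW).
have -> : x = j r' * j (w0 * w) * x - (j r' * j (w0 * w) * x - x) by rewrite opprB addrC subrK.
apply: dualB => //.
have -> : j r' * j (w0 * w) * x = j (r' * w0 * r) * c.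
  by rewrite !rmorphM -!mulrA E'; ring.
exact: dualM.
Qed.

(** Hom_Z(R, Q/Z) is K modulo the dual lattice. [lam] applies [tau] to a primary representative,
    which is unique modulo that lattice; [Pi] multiplies a representative by [d] and so forgets its
    other primary parts. *)
Lemma ev_quotient_injective : injective_module E1.
Proof.
have ex y : exists x, primary x /\ pi1 (local_part (d * x)) = y.
  by have [x] := primary_exists y; exists x.
have [x xP] := choice ex.
have lamE z y : primary z -> pi1 (local_part (d * z)) = y ->
    mod_int (tau (x y)) = mod_int (tau z).
  move=> pz zy; apply/eqP; rewrite -subr_eq0 -!raddfB /=; apply/eqP/mod_int_eq0.
  have [px xy] := xP y; rewrite -[_ - z]mul1r -(rmorph1 j).
  apply: primary_unique; first exact: primaryB.
  by rewrite mulrBr !raddfB /= xy zy subrr.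
pose lam y := mod_int (tau (x y)).
have lam_add : zmod_morphism lam.
  move=> y z; have [py xy] := xP y; have [pz xz] := xP z.
  rewrite /lam (lamE (x y - x z)) ?raddfB //; first exact: primaryB.
  by rewrite mulrBr !raddfB /= xy xz.
pose lamM := GRing.isZmodMorphism.Build E1 rat_mod_int lam lam_add.
pose lam' : {additive E1 -> rat_mod_int} := HB.pack lam lamM.
have exX phi : exists x, zmod_morphism phi -> forall r, phi r = mod_int (tau (j r * x)).
  have [/tau_rep_mod[z zP]|no] := pselect (zmod_morphism phi); first by exists z.
  by exists 0 => /no.
have [X XP] := choice exX; pose Pi phi : E1 := pi1 (local_part (d * X phi)).
have PiE phi z : zmod_morphism phi -> (forall r, phi r = mod_int (tau (j r * z))) ->
    Pi phi = pi1 (local_part (d * z)).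
  move=> phi_add zP; apply/module_quotient_piP; rewrite -raddfB -mulrBr.
  have [|s sP] := @dual_ev (X phi - z).
    move=> r; apply/mod_int_eq0; rewrite mulrBr !raddfB /=.
    by rewrite -XP // -zP subrr.
  by apply/asboolP; exists s; apply/val_inj; rewrite /= sP ev_fix.
apply: (injective_of_functionals (lam := lam') (Pi := Pi) divisible_rat_mod_int).
- move=> phi psi phiD psiD.
  rewrite [RHS](_ : _ = pi1 (local_part (d * (X phi - X psi)))).
    apply: PiE => [y z|r]; first by rewrite /= phiD psiD !opprD addrACA.
    by rewrite /= mulrBr !raddfB /= -!XP.
  by rewrite /Pi -!raddfB -mulrBr.
- move=> r phi phiD; rewrite /Pi -linearZ -local_partM mulrCA; apply: PiE => [y z|s].
    by rewrite mulrBl phiD.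
  by rewrite mulrA -rmorphM; exact: XP.
- move=> y; have [py xy] := xP y; rewrite -[RHS]xy; apply: PiE => [r s|r].
    by rewrite rmorphB scalerBl raddfB.
  rewrite /= /lam (lamE (j r * x y)) //; first exact: primaryM.
  by rewrite mulrCA local_partM linearZ /= xy.
Qed.

Lemma zero_module_injective (T : comNzRingType) (M : lmodType T) :
  (forall x : M, x = 0) -> injective_module M.
Proof. by move=> M0 A B i h _; exists (\0 : {linear B -> M}) => a; rewrite [RHS]M0. Qed.

Definition resolution_module (i : nat) : lmodType S :=
  match i with 0 => local_algebra | 1 => E1 | _ => 'rV[S]_0 end.

Definition resolution_map (i : nat) :
    {linear resolution_module i -> resolution_module i.+1} :=
  match i return {linear resolution_module i -> resolution_module i.+1} with
  | 0 => pi1 : {linear local_algebra -> E1}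
  | i'.+1 => \0
  end.

Lemma finite_injective_dimension_localization :
  finite_injective_dimension (S^o : lmodType S).
Proof.
exists 1, resolution_module, ev_module, resolution_map; split.
- move=> [|[|i]]; [exact: local_algebra_injective|exact: ev_quotient_injective|].
  by apply: zero_module_injective => x; exact: thinmx0.
- exact: ev_module_inj.
- move=> x; split=> [|[s ->]].
    rewrite /= -(raddf0 pi1) => /module_quotient_piP.
    by rewrite subr0 => /asboolP[s ->]; exists s.
  rewrite /= -(raddf0 pi1); apply/module_quotient_piP; rewrite subr0.
  by apply/asboolP; exists s.
- move=> [|i] x; split=> // _.
    by have [v <-] := module_quotient_pi_sur x; exists v.
  by exists 0; rewrite [LHS]thinmx0 raddf0.
- by move=> [|[|i]] // _ x; exact: thinmx0.
Qed.

End Resolution.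

(** * Coordinates in the ring of a form *)

(** Echelon form in Z^n: for each m, one element of [I] with least nonzero |c_m|, among those whose
    later coordinates vanish, reduces the others by Euclidean division. *)
Lemma noetherian_of_coords (R : comNzRingType) (n : nat) (c : nat -> R -> int) :
  (forall k, (k < n)%N -> zmod_morphism (c k)) ->
  (forall x, (forall k, (k < n)%N -> c k x = 0) -> x = 0) ->
  noetherian R.
Proof.
move=> cB c_inj I.
have cMz k x m : (k < n)%N -> c k (x *~ m) = c k x * m.
  move=> /cB ckB; pose ckM := GRing.isZmodMorphism.Build R int (c k) ckB.
  pose ck : {additive R -> int} := HB.pack (c k) ckM.
  by have := raddfMz ck m x; rewrite -mulrzz.
suff: forall m, (m <= n)%N -> exists s : seq R, all (mem (I : pred R)) s /\
    forall x, x \in (I : pred R) -> (forall k, (m <= k < n)%N -> c k x = 0) ->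
    exists a : 'I_(size s) -> R, x = \sum_(i < size s) a i * s`_i.
  move=> /(_ n (leqnn n))[s [sI sP]]; exists s => x; split=> [xI|[a ->]].
    by apply: sP => // k; rewrite leqNgt; case: ltnP.
  by apply: rpred_sum => i _; apply: idealMr; exact: (allP sI) _ (mem_nth 0 (ltn_ord i)).
elim=> [_|m IH lt_mn].
  exists [::]; split=> // x _ x0; exists (fun=> 0).
  by rewrite big_ord0; apply: c_inj => k lt_kn; exact: x0.
have [s [sI sP]] := IH (ltnW lt_mn).
pose J x := x \in (I : pred R) /\ forall k, (m < k < n)%N -> c k x = 0.
have JB x y a : J x -> J y -> J (x - y *~ a).
  move=> [xI x0] [yI y0]; split.
    by apply: rpredB => //; rewrite -mulrzr mulrC; exact: idealMr.
  move=> k km; rewrite cB ?cMz ?x0 ?y0 ?mul0r ?subr0 //; by case/andP: km.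
have [[y0 Jy0 cy0]|no] := pselect (exists2 x, J x & c m x != 0); last first.
  exists s; split=> // x xI x0; apply: sP => // k /andP[].
  rewrite leq_eqVlt => /predU1P[<- _|lt_mk lt_kn]; last by apply: x0; rewrite lt_mk.
  by apply: contrapT => /eqP cx; apply: no; exists x.
have ex : exists k, `[< exists x, [/\ J x, c m x != 0 & `|c m x|%N = k] >].
  by exists `|c m y0|%N; apply/asboolP; exists y0.
case: (ex_minnP ex) => _ /asboolP[y [Jy cy <-]] ymin.
exists (y :: s); split=> [|x xI x0]; first by rewrite /= sI andbT; exact: Jy.1.
have Jx : J x by [].
pose x' := x - y *~ (c m x %/ c m y)%Z.
have Jx' : J x' by exact: JB.
have cx' : c m x' = (c m x %% c m y)%Z.
  by rewrite cB ?cMz // {1}(divz_eq (c m x) (c m y)) mulrC addrAC subrr add0r.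
have [|a aP] := sP x' Jx'.1.
  move=> k /andP[]; rewrite leq_eqVlt => /predU1P[<- _|lt_mk lt_kn]; last first.
    by apply: Jx'.2; rewrite lt_mk.
  apply/eqP; apply: contraT => cx'0.
  have := ymin _ (asboolT (ex_intro _ x' (And3 Jx' cx'0 erefl))).
  by rewrite cx'; have := modz_ge0 (c m x) cy; have := ltz_mod (c m x) cy; lia.
exists (fun i => if unlift ord0 i is Some k then a k else ((c m x %/ c m y)%Z)%:~R).
rewrite big_ord_recl unlift_none /= mulrC mulrzr.
under eq_bigr do rewrite liftK.
by rewrite -aP addrC subrK.
Qed.

Lemma loc_common_denominator (R : comNzRingType) (q : prime_idealr R) (n : nat)
    (x : 'I_n -> localization q) :
  exists2 w, w \notin (q : pred R) &
    exists r : 'I_n -> R, forall i, loc q w * x i = loc q (r i).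
Proof.
have ex i : exists wr, wr.1 \notin (q : pred R) /\ loc q wr.1 * x i = loc q wr.2.
  by have [w wW [r wr]] := loc_frac (x i); exists (w, r).
have [wr wrP] := choice ex; exists (\prod_i (wr i).1).
  elim/big_ind: _ => [|u v|i _]; last exact: (wrP i).1.
    exact: Localization.one_notin.
  exact: Localization.mul_notin.
exists (fun i => (wr i).2 * \prod_(k < n | k != i) (wr k).1) => i.
by rewrite (bigD1 i) //= !rmorphM /= -(wrP i).2 mulrAC.
Qed.

Section FormRing.
Variables (n : nat) (f : binary_form n).
Hypotheses (n_gt1 : (1 < n)%N) (f0 : f 0 0 != 0).

Local Notation K := (form_algebra f).
Local Notation R := (form_ring f).
Local Notation j := (val : {rmorphism R -> K}).

(** By duality of the two bases this rational is an integer when k < n, and [numq] reads it off. *)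
Definition coord (k : nat) (x : R) : int := numq (tau (val x * zeta_dual f k)).

Definition zsum_ring (k : nat) : R := insubd 0 (zsum f k).
Definition zeta_ring (k : nat) : R := insubd 0 (zeta f k).

Lemma val_zsum k : (k <= n)%N -> val (zsum_ring k) = zsum f k.
Proof. by move=> le_kn; apply: insubdK; exact: zsum_mem. Qed.

Lemma val_zeta k : (k < n)%N -> val (zeta_ring k) = zeta f k.
Proof. by move=> lt_kn; apply: insubdK; exact: zeta_mem. Qed.

Lemma zeta_ring0 : zeta_ring 0 = 1.
Proof. by apply/val_inj; rewrite val_zeta ?rmorph1 // ltnW. Qed.

Lemma zeta_ring_zsum k : (0 < k < n)%N -> zeta_ring k = zsum_ring k.
Proof.
move=> /andP[k0 kn]; apply/val_inj.
by rewrite val_zeta // val_zsum ?(ltnW kn) // zeta_zsum.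
Qed.

Lemma form_ring_span (x : R) : exists c : nat -> int, x = \sum_(k < n) zeta_ring k *~ c k.
Proof.
have /asboolP[c xc] : val x \in @form_ring_pred n f by case: x.
exists (fun k => c (inord k)); apply/val_inj; rewrite xc raddf_sum.
have ord_eq (g : nat -> K) a b : a = b -> \sum_(k < a) g k = \sum_(k < b) g k.
  by move=> ->.
transitivity (\sum_(k < n.-1.+1) zeta f k *~ c (inord k)).
  by apply: eq_bigr => k _; rewrite inord_val.
rewrite (ord_eq (fun k => zeta f k *~ c (inord k)) _ n) ?prednK ?(ltnW n_gt1) //.
by apply: eq_bigr => k _; rewrite raddfMz /= val_zeta.
Qed.

Lemma tau_zeta_sum (c : nat -> int) k : (k < n)%N ->
  tau (val (\sum_(i < n) zeta_ring i *~ c i) * zeta_dual f k) = (c k)%:~R.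
Proof.
have term i : (i < n)%N -> (k < n)%N ->
    tau (val (zeta_ring i *~ c i) * zeta_dual f k) = (i == k)%:R *~ c i.
  by move=> *; rewrite raddfMz /= mulrzAl raddfMz /= val_zeta // tau_zeta_dual.
move=> lt_kn; rewrite raddf_sum mulr_suml raddf_sum (bigD1 (Ordinal lt_kn)) //=.
rewrite term // eqxx big1 ?addr0 // => i.
by rewrite -val_eqE /= term // => /negPf ->; rewrite mul0rz.
Qed.

Lemma coord_zeta_sum (c : nat -> int) k : (k < n)%N ->
  coord k (\sum_(i < n) zeta_ring i *~ c i) = c k.
Proof. by move=> lt_kn; rewrite /coord tau_zeta_sum // numq_int. Qed.

Lemma coordE k x : (k < n)%N -> (coord k x)%:~R = tau (val x * zeta_dual f k).
Proof.
by have [c ->] := form_ring_span x => lt_kn; rewrite coord_zeta_sum // tau_zeta_sum.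
Qed.

Lemma coord_sum x : x = \sum_(k < n) zeta_ring k *~ coord k x.
Proof.
have [c xc] := form_ring_span x; rewrite {1}xc.
by apply: eq_bigr => k _; rewrite xc coord_zeta_sum.
Qed.

Lemma coord_zmod k : (k < n)%N -> zmod_morphism (coord k).
Proof.
move=> lt_kn x y; apply: (intr_inj (R := rat)).
by rewrite rmorphB /= !coordE // rmorphB mulrBl raddfB.
Qed.

Lemma coordD k x y : (k < n)%N -> coord k (x + y) = coord k x + coord k y.
Proof.
move=> lt_kn; apply: (intr_inj (R := rat)).
by rewrite rmorphD /= !coordE // rmorphD mulrDl raddfD.
Qed.

Lemma coordMz k x m : (k < n)%N -> coord k (x *~ m) = coord k x * m.
Proof.
move=> lt_kn; apply: (intr_inj (R := rat)).
by rewrite rmorphM /= !coordE // raddfMz /= mulrzAl raddfMz /= mulrzr.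
Qed.

Lemma coord_zeta k l : (k < n)%N -> (l < n)%N -> coord k (zeta_ring l) = (l == k)%:R.
Proof.
move=> lt_kn lt_ln; apply: (intr_inj (R := rat)).
by rewrite coordE // val_zeta // tau_zeta_dual //; case: (l == k).
Qed.

Lemma coord_inj0 x : (forall k, (k < n)%N -> coord k x = 0) -> x = 0.
Proof. by move=> x0; rewrite [x]coord_sum big1 // => k _; rewrite x0. Qed.

Lemma coord_int k m : (k < n)%N -> coord k m%:~R = if k == 0%N then m else 0.
Proof.
move=> lt_kn; rewrite -[m%:~R]/(1 *~ m) coordMz // -zeta_ring0 coord_zeta ?(ltnW n_gt1) //.
by rewrite eq_sym; case: (k == 0%N); rewrite ?mul1r ?mul0r.
Qed.

Lemma form_ring_divz (x : R) m : m != 0 -> (forall k, (k < n)%N -> (m %| coord k x)%Z) ->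
  exists y, x = y *~ m.
Proof.
move=> m0 mx; exists (\sum_(k < n) zeta_ring k *~ (coord k x %/ m)%Z).
rewrite mulrz_suml {1}[x]coord_sum; apply: eq_bigr => k _.
by rewrite -mulrzA divzK // mx.
Qed.

Lemma form_ring_torsion_free (x : R) m : m != 0 -> x *~ m = 0 -> x = 0.
Proof.
move=> m0 xm; apply: coord_inj0 => k lt_kn.
have := coordMz x m lt_kn; rewrite xm -[0]/(0%:~R) coord_int //.
by case: (k == 0%N) => /esym/eqP; rewrite mulf_eq0 (negPf m0) orbF => /eqP.
Qed.

Lemma form_ring_noetherian : noetherian R.
Proof. exact: noetherian_of_coords coord_zmod coord_inj0. Qed.

Lemma tau_nondegenerate_ring x : (forall r, tau (j r * x) = 0) -> x = 0.
Proof.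
move=> x0; apply: zeta_nondegenerate => // k lt_kn.
by rewrite mulrC -val_zeta //; exact: x0.
Qed.

Lemma tau_interpolation (l : nat -> rat) :
  exists x, forall r, tau (j r * x) = \sum_(k < n) l k * (coord k r)%:~R.
Proof.
exists (\sum_(k < n) cst f (l k) * zeta_dual f k) => r.
rewrite mulr_sumr raddf_sum; apply: eq_bigr => k _.
by rewrite /= mulrCA tau_cst //; congr (_ * _); apply/esym; exact: coordE.
Qed.

Lemma additive_coord (A : zmodType) (phi : R -> A) : zmod_morphism phi ->
  forall r, phi r = \sum_(k < n) phi (zeta_ring k) *~ coord k r.
Proof.
move=> phiB r; pose phiM := GRing.isZmodMorphism.Build R A phi phiB.
pose p : {additive R -> A} := HB.pack phi phiM.
rewrite -[LHS]/(p r) {1}[r]coord_sum raddf_sum; apply: eq_bigr => k _.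
by rewrite raddfMz.
Qed.

Lemma tau_represent (phi : R -> rat) : zmod_morphism phi ->
  exists x, forall r, phi r = tau (j r * x).
Proof.
move=> /additive_coord phiE; have [x xP] := tau_interpolation (phi \o zeta_ring).
exists x => r; rewrite phiE xP; apply: eq_bigr => k _.
by rewrite mulrzr.
Qed.

Lemma tau_represent_mod_int (phi : R -> rat_mod_int) : zmod_morphism phi ->
  exists x, forall r, phi r = mod_int (tau (j r * x)).
Proof.
move=> /additive_coord phiE.
have [l lP] := choice (fun k => mod_int_sur (phi (zeta_ring k))).
have [x xP] := tau_interpolation l.
exists x => r; rewrite phiE xP raddf_sum; apply: eq_bigr => k _.
by rewrite mulrzr raddfMz /= lP.
Qed.

Lemma dual_zeta_dual k : (k < n)%N -> dual j (@tau n f) (zeta_dual f k).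
Proof.
move=> lt_kn r; have : ((coord k r)%:~R : rat) \is a Num.int by exact: intr_int.
by rewrite coordE.
Qed.

Lemma zeta_dual_last : zeta_dual f n.-1 = 1.
Proof. by case: n n_gt1 f => [|[|m]] //= _ g; rewrite subnn. Qed.

Lemma dual_torsion x : exists2 m, (0 < m)%N & dual j (@tau n f) (x *+ m).
Proof.
have [m m_gt0 xm] := multiple_in_span n_gt1 f0 x; exists m => // r.
have -> : x *+ m = j (FormRing xm) by [].
rewrite -rmorphM -[j _]mulr1 -zeta_dual_last; apply: dual_zeta_dual.
by lia.
Qed.

Lemma dual_expansion x : dual j (@tau n f) x ->
  exists l : nat -> int, x = \sum_(k < n) (l k)%:~R * zeta_dual f k.
Proof.
move=> xd; exists (fun k => numq (tau (x * zeta f k))).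
have := @zeta_dual_expansion n f n_gt1 f0 x (fun k => tau (x * zeta f k)) (fun _ _ => erefl).
move=> {1}->; apply: eq_bigr => k _; rewrite -(rmorph_int (cst f)); congr (cst f _ * _).
have /intrP[m mE] : tau (x * zeta f k) \is a Num.int.
  by rewrite mulrC -val_zeta //; exact: xd.
by rewrite mE numq_int.
Qed.

(** * Denominators outside a prime of the form ring *)

Section Local.
Variable q : prime_idealr R.
Local Notation W := (fun w : R => w \notin (q : pred R)).

(** R/m is finite: [rho] reduces coordinates modulo [m], and [w] is taken with the fewest multiples
    modulo [m], so that [w' * w] has the same multiples. *)
Lemma outside_stable_mod m : (0 < m)%N -> exists2 w, W w &
  forall w', W w' -> exists r y, r * w' * w - w = y *+ m.
Proof.
move=> m_gt0; pose rho (x : R) : {ffun 'I_n -> 'I_m.-1.+1} :=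
  [ffun k : 'I_n => inord `|(coord k x %% m)%Z|].
have m0 : m%:Z != 0 by rewrite -lt0n.
have rhoP x y : rho x = rho y -> exists z, x - y = z *+ m.
  move=> /ffunP e; have [k lt_kn|z ->] := @form_ring_divz (x - y) m m0; last by exists z.
  have := e (Ordinal lt_kn); rewrite !ffunE => /(congr1 (@nat_of_ord _)).
  have bnd (a : int) : (`|(a %% m)%Z| < m.-1.+1)%N.
    by have := modz_ge0 a m0; have := ltz_pmod a (m_gt0 : 0 < m%:Z); lia.
  rewrite /= !inordK // => eabs; rewrite coord_zmod //.
  rewrite -eqz_mod_dvd; apply/eqP.
  by rewrite -(gez0_abs (modz_ge0 (coord k x) m0)) eabs gez0_abs // modz_ge0.
pose Im (w : R) : {set {ffun 'I_n -> 'I_m.-1.+1}} :=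
  [set t | `[< exists r, rho (r * w) = t >]]%SET.
have ImP w t : t \in Im w <-> exists r, rho (r * w) = t.
  by rewrite finset.in_set; split=> [/asboolP//|h]; apply/asboolP.
have ex : exists k, `[< exists2 w, W w & #|Im w| = k >].
  by exists #|Im 1|; apply/asboolP; exists 1 => //; exact: Localization.one_notin.
case: (ex_minnP ex) => _ /asboolP[w wW <-] wmin; exists w => // w' w'W.
have sub : Im (w' * w) \subset Im w.
  apply/fintype.subsetP => t /ImP[r rt]; apply/ImP.
  by exists (r * w'); rewrite -mulrA.
have eqI : Im (w' * w) = Im w.
  apply/eqP; rewrite eqEcard sub; apply: wmin; apply/asboolP.
  by exists (w' * w) => //; exact: Localization.mul_notin.
have : rho w \in Im w by apply/ImP; exists 1; rewrite mul1r.
rewrite -eqI => /ImP[r /rhoP[z rz]]; exists r, z.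
by rewrite -mulrA.
Qed.

(** Let [w0] generate a least ideal of K among the elements outside q. Then [z * (w0 * w0) = w0] for
    some [z], and [z * w0] is an idempotent generating that ideal, on which every denominator acts
    bijectively. *)
Lemma local_idempotent : exists e w0, [/\ e * e = e, W w0,
  forall x : K, e * x = 0 -> j w0 * x = 0 &
  forall w, W w -> exists2 t, e * t = t & t * j w = e].
Proof.
have [|_ _ [r [rW ->]] [s [sW ->]]|_ [w0 [w0W ->]] w0P] :=
    @stable_power n f n_gt1 f0 (fun x => exists r, W r /\ x = j r) 1.
- by exists 1; rewrite rmorph1; split=> //; exact: Localization.one_notin.
- by exists (r * s); rewrite rmorphM; split=> //; exact: Localization.mul_notin.
have [z zP] := w0P _ (ex_intro _ w0 (conj w0W erefl)).
have ew0 : z * j w0 * j w0 = j w0 by rewrite -mulrA.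
exists (z * j w0), w0; split=> //.
- by transitivity (z * (z * (j w0 * j w0))); [ring | rewrite zP].
- by move=> x ex0; rewrite -ew0 mulrAC ex0 mul0r.
- move=> w wW; have [t tP] := w0P _ (ex_intro _ w (conj wW erefl)).
  (* This is [e * e * t] for the idempotent [e], which is [z * j w0]. *)
  exists (z * (z * t * (j w0 * j w0))).
    transitivity (z * z * t * (z * (j w0 * j w0)) * j w0); first by ring.
    by rewrite zP; ring.
  transitivity (z * (z * (t * (j w * j w0) * j w0))); first by ring.
  by rewrite tP zP.
Qed.

End Local.
End FormRing.

(** * Primitive forms *)

Section Primitive.
Variables (n : nat) (f : binary_form n).
Hypotheses (n_gt1 : (1 < n)%N) (f0 : f 0 0 != 0).

Local Notation K := (form_algebra f).
Local Notation R := (form_ring f).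
Local Notation j := (val : {rmorphism R -> K}).
Local Notation th := (theta f).
Variable q : prime_idealr R.
Local Notation W := (fun w : R => w \notin (q : pred R)).

(** A denominator for theta: theta times it is [zsum_ring f k.+1]. *)
Definition zeta_shift (k : nat) : R := zsum_ring f k + (f 0 (inord k))%:~R.

Lemma theta_zeta_shift k : (k < n)%N -> th * j (zeta_shift k) = j (zsum_ring f k.+1).
Proof.
move=> lt_kn; rewrite /zeta_shift rmorphD rmorph_int /= !val_zsum ?(ltnW lt_kn) //.
by rewrite zsumS.
Qed.

(** Otherwise q would contain every f_k with k < n, as the difference of [zeta_shift k] and
    [zsum_ring f k], and also f_n, the opposite of [zsum_ring f n]. *)
Lemma theta_or_inverse_local : primitive_form f ->
  (exists2 k, (k < n)%N & W (zeta_shift k)) \/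
  (exists2 k, (k < n)%N & W (zsum_ring f k.+1)).
Proof.
move=> [u uf]; apply: contrapT => /not_orP[no1 no2].
have in1 k : (k < n)%N -> zeta_shift k \in (q : pred R).
  by move=> lt_kn; apply: contrapT => /negP h; apply: no1; exists k.
have in2 k : (k < n)%N -> zsum_ring f k.+1 \in (q : pred R).
  by move=> lt_kn; apply: contrapT => /negP h; apply: no2; exists k.
have zs0 : zsum_ring f 0 = 0 by apply/val_inj; rewrite val_zsum // zsum0 rmorph0.
have fq (i : 'I_n.+1) : (f 0 i)%:~R \in (q : pred R).
  have [lt_in|ge_in] := ltnP i n.
    have -> : (f 0 i)%:~R = zeta_shift i - zsum_ring f i.
      by rewrite /zeta_shift addrAC subrr add0r inord_val.
    apply: rpredB; first exact: in1.
    by case: (val i) lt_in => [|k] lt_kn; [rewrite zs0 rpred0 | apply: in2; exact: ltnW].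
  have -> : i = ord_max by apply/val_inj/eqP; rewrite eqn_leq ge_in -ltnS ltn_ord.
  have e : zsum_ring f n = - (f 0 ord_max)%:~R.
    by apply/val_inj; rewrite val_zsum // zsum_last // !rmorphN !rmorph_int.
  have n0 : (n.-1.+1 = n)%N by lia.
  by rewrite -rpredN -e -[in X in zsum_ring f X]n0; apply: in2; rewrite n0.
have : (1 : R) \in (q : pred R); last by rewrite idealr1.
rewrite -(rmorph1 (intr : {rmorphism int -> R})) -uf rmorph_sum; apply: rpred_sum => i _.
by rewrite rmorphM; apply: idealMr; exact: fq.
Qed.

Section Fractions.
Variables (e : K).
Hypothesis ee : e * e = e.

(** For [x] in [e] K: [x] comes from R_q. *)
Definition local_fraction (x : K) := exists w r, W w /\ j w * x = e * j r.

Lemma local_fractionD x y :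
  local_fraction x -> local_fraction y -> local_fraction (x + y).
Proof.
move=> [v [r [vW vr]]] [w [s [wW ws]]]; exists (v * w), (w * r + v * s).
split; first exact: Localization.mul_notin.
rewrite rmorphD !rmorphM mulrDr mulrAC vr -mulrA ws.
by ring.
Qed.

Lemma local_fractionM x y :
  local_fraction x -> local_fraction y -> local_fraction (x * y).
Proof.
move=> [v [r [vW vr]]] [w [s [wW ws]]]; exists (v * w), (r * s).
split; first exact: Localization.mul_notin.
by rewrite !rmorphM mulrACA vr ws mulrACA ee.
Qed.

Lemma local_fraction_ring r : local_fraction (e * j r).
Proof.
exists 1, r; rewrite rmorph1 mul1r; split=> //; exact: Localization.one_notin.
Qed.

Lemma local_fractionX x i : local_fraction (e * x) -> local_fraction (e * x ^+ i).
Proof.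
move=> ex; elim: i => [|i IH].
  by rewrite expr0 -(rmorph1 j); exact: local_fraction_ring.
rewrite exprS -[e in e * (x * _)]ee.
have -> : e * e * (x * x ^+ i) = e * x * (e * x ^+ i) by ring.
exact: local_fractionM.
Qed.

Lemma dual_local_fraction (d x : K) :
  (forall k, (k < n)%N -> local_fraction (e * (d * zeta_dual f k))) ->
  dual j (@tau n f) x -> local_fraction (e * (d * x)).
Proof.
move=> dk /(dual_expansion n_gt1 f0)[l ->].
rewrite mulr_sumr mulr_sumr; elim/big_ind: _ => [||k _].
- by rewrite -[0](mulr0 e) -(rmorph0 j); exact: local_fraction_ring.
- exact: local_fractionD.
- have -> : e * (d * ((l k)%:~R * zeta_dual f k))
      = (e * j (l k)%:~R) * (e * (d * zeta_dual f k)).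
    rewrite rmorph_int -[in LHS]ee; ring.
  by apply: local_fractionM; [exact: local_fraction_ring | exact: dk].
Qed.

End Fractions.

(** If theta is in R_q, the dual lattice is locally R_q and c = d = 1. If theta has an inverse [u]
    in R_q, it is locally generated by theta^(n-2), which is [zeta_dual f 1], and d = u^(n-2). *)
Lemma local_duality e : primitive_form f -> e * e = e ->
  (forall w, W w -> exists2 t, e * t = t & t * j w = e) ->
  exists c d, [/\ c * d * e = e, dual j (@tau n f) c
    & forall x, dual j (@tau n f) x -> local_fraction e (e * (d * x))].
Proof.
move=> prim ee e_inv.
have zd0 : zeta_dual f 0 = j (zeta_shift n.-1).
  rewrite rmorphD rmorph_int /= val_zsum //; lia.
case: (theta_or_inverse_local prim) => -[k lt_kn kW].
  exists 1, 1; split; first by rewrite !mul1r.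
    by rewrite -(zeta_dual_last f n_gt1); apply: dual_zeta_dual => //; lia.
  move=> x; apply: dual_local_fraction => // i lt_in; rewrite mul1r.
  case: i lt_in => [|i] lt_in; first by rewrite zd0; exact: local_fraction_ring.
  apply: local_fractionX => //; exists (zeta_shift k), (zsum_ring f k.+1).
  by split=> //; rewrite -theta_zeta_shift //; ring.
have [t et tw] := e_inv _ kW; pose u := t * j (zeta_shift k).
have thu : th * u = e by rewrite /u mulrCA theta_zeta_shift.
have eu : e * u = u by rewrite /u mulrA et.
have eX i : e ^+ i * e = e by elim: i => [|i IH]; rewrite ?mul1r // exprS -mulrA IH.
exists (th ^+ (n.-1 - 1)), (u ^+ (n.-1 - 1)); split.
- by rewrite -exprMn thu eX.
- by apply: (dual_zeta_dual _ _ (k := 1)).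
move=> x; apply: dual_local_fraction => // i lt_in.
have uf : local_fraction e (e * u).
  exists (zsum_ring f k.+1), (zeta_shift k); split=> //.
  by rewrite eu /u mulrA [j _ * t]mulrC tw.
case: i lt_in => [|i] lt_in.
  rewrite zd0 -[e in X in local_fraction _ X]ee.
  have -> : e * e * (u ^+ (n.-1 - 1) * j (zeta_shift n.-1))
    = e * u ^+ (n.-1 - 1) * (e * j (zeta_shift n.-1)) by ring.
  apply: local_fractionM => //; [exact: local_fractionX | exact: local_fraction_ring].
have -> : (n.-1 - 1 = i + (n.-1 - i.+1))%N by lia.
rewrite exprD -[zeta_dual f i.+1]/(th ^+ (n.-1 - i.+1)).
have -> : e * (u ^+ i * u ^+ (n.-1 - i.+1) * th ^+ (n.-1 - i.+1))
    = e * u ^+ i.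
  rewrite -mulrA -exprMn [u * th]mulrC thu [u ^+ i * _]mulrC mulrA.
  by rewrite [e * _]mulrC eX.
exact: local_fractionX.
Qed.

Lemma primitive_finite_injective_dimension : primitive_form f ->
  finite_injective_dimension ((localization q)^o : lmodType (localization q)).
Proof.
move=> prim; have [e [w0 [ee w0W e_ker e_inv]]] := local_idempotent n_gt1 f0 q.
have [c [d [cde dual_c dual_frac]]] := local_duality prim ee e_inv.
apply: (@finite_injective_dimension_localization R K j q e w0 val_inj ee w0W e_ker e_inv
  (@tau n f) _ _ _ c d cde dual_c dual_frac).
- exact: tau_nondegenerate_ring.
- exact: tau_represent.
- exact: tau_represent_mod_int.
- exact: dual_torsion.
- exact: outside_stable_mod.
Qed.

End Primitive.

(** * Forms with content divisible by a prime *)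

(** The least positive absolute value in the ideal of the coefficients divides them all, and it is
    not 1. *)
Lemma not_primitive_prime (n : nat) (f : binary_form n) :
  f 0 0 != 0 -> ~ primitive_form f ->
  exists2 p : nat, prime p & forall i, (p %| f 0%R i)%Z.
Proof.
move=> f0 not_prim.
pose I (m : int) := exists u : 'I_n.+1 -> int, \sum_i u i * f 0 i = m.
have If i : I (f 0 i).
  exists (fun k => (k == i)%:R); rewrite (bigD1 i) //= eqxx mul1r big1 ?addr0 //.
  by move=> k /negPf ->; rewrite mul0r.
have IB a b m : I a -> I b -> I (a - m * b).
  move=> [u <-] [v <-]; exists (fun i => u i - m * v i).
  by rewrite mulr_sumr -sumrB; apply: eq_bigr => i _; rewrite mulrBl mulrA.
have ex : exists k, (0 < k)%N && `[< exists2 m, I m & `|m|%N = k >].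
  exists `|f 0%R 0%R|%N; rewrite absz_gt0 f0; apply/asboolP; exists (f 0 0) => //; exact: If.
case: (ex_minnP ex) => d /andP[d_gt0 /asboolP[m Im md]] dmin.
have m0 : m != 0 by rewrite -absz_gt0 md.
have m_dvd i : (m %| f 0%R i)%Z.
  apply/dvdz_mod0P; set r := (_ %% _)%Z; apply/eqP; apply: contraT => r0.
  have := dmin `|r|%N; rewrite absz_gt0 r0 asboolT /=; last first.
    exists r => //; have := IB _ _ (f 0%R i %/ m)%Z (If i) Im.
    by rewrite {1}(divz_eq (f 0 i) m) addrAC subrr add0r.
  move=> /(_ isT); rewrite -md.
  by have := modz_ge0 (f 0 i) m0; have := ltz_mod (f 0 i) m0; rewrite -/r; lia.
have d_neq1 : d != 1%N.
  apply/eqP => d1; apply: not_prim; rewrite d1 in md.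
  have I0 : I 0 by have := IB _ _ 1 Im Im; rewrite mul1r subrr.
  have := IB _ _ (- m) I0 Im; rewrite mulNr sub0r opprK.
  by have -> : m * m = 1 by lia.
exists (pdiv d) => [|i]; first by apply: pdiv_prime; lia.
apply: dvdz_trans (m_dvd i); rewrite dvdzE md /=; exact: pdiv_dvd.
Qed.

Fact mul_sub_expand (A : comNzRingType) (x y c d : A) :
  x * y = c * d + ((y - d) * c + (x - c) * d + (x - c) * (y - d)).
Proof. by ring. Qed.

Section NonPrimitive.
Variables (n : nat) (f : binary_form n) (p : nat).
Hypotheses (n_gt2 : (2 < n)%N) (f0 : f 0 0 != 0).
Hypotheses (p_prime : prime p) (pf : forall i, (p %| f 0%R i)%Z).

Local Notation K := (form_algebra f).
Local Notation R := (form_ring f).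
Local Notation j := (val : {rmorphism R -> K}).

Let n_gt1 : (1 < n)%N. Proof. exact: ltnW. Qed.
Let n_gt0 : (0 < n)%N. Proof. exact: ltnW. Qed.
Let p_neq0 : p%:Z != 0. Proof. by rewrite -lt0n prime_gt0. Qed.

Definition p_multiple (x : R) : Prop := exists y, x = y *+ p.

Lemma p_multipleD x y : p_multiple x -> p_multiple y -> p_multiple (x + y).
Proof. by move=> [u ->] [v ->]; exists (u + v); rewrite mulrnDl. Qed.

Lemma p_multipleM x y : p_multiple y -> p_multiple (x * y).
Proof. by move=> [v ->]; exists (x * v); rewrite mulrnAr. Qed.

Lemma p_multiple_form i : p_multiple (f 0 i)%:~R.
Proof.
have /dvdzP[m ->] := pf i; exists m%:~R.
by rewrite rmorphM mulr_natr.
Qed.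

(** An index is moved from the left factor to the right one until zsum 0 = 0 or zsum n = - f_n
    appears; each correction carries a coefficient of the form. *)
Lemma zsum_ring_mul i k : (i <= n)%N -> (k <= n)%N ->
  p_multiple (zsum_ring f i * zsum_ring f k).
Proof.
have last : p_multiple (zsum_ring f n).
  have -> : zsum_ring f n = (-1) * (f 0 ord_max)%:~R.
    apply/val_inj; rewrite val_zsum // zsum_last // mulN1r !rmorphN !rmorph_int.
    by [].
  by apply: p_multipleM; exact: p_multiple_form.
elim: i k => [|i IH] k le_in le_kn.
  exists 0; apply/val_inj.
  by rewrite mul0rn rmorphM /= val_zsum // zsum0 mul0r.
move: le_kn; rewrite leq_eqVlt => /orP[/eqP ->|lt_kn]; first exact: p_multipleM.
have -> : zsum_ring f i.+1 * zsum_ring f k = zsum_ring f i * zsum_ring f k.+1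
    + (zsum_ring f k.+1 * (f 0 (inord i))%:~R - zsum_ring f i.+1 * (f 0 (inord k))%:~R).
  apply/val_inj; rewrite rmorphD rmorphB !rmorphM !rmorph_int /=.
  rewrite !val_zsum ?(ltnW lt_kn) ?(ltnW le_in) // !zsumS //.
  by ring.
apply: p_multipleD; first exact: IH (ltnW le_in) lt_kn.
apply: p_multipleD; first by apply: p_multipleM; exact: p_multiple_form.
by rewrite -mulrN; apply: p_multipleM; have [y ->] := p_multiple_form (inord k);
  exists (- y); rewrite mulNrn.
Qed.

Lemma zeta_ring_mul i k : (0 < i < n)%N -> (0 < k < n)%N ->
  p_multiple (zeta_ring f i * zeta_ring f k).
Proof.
move=> /andP[i0 lt_in] /andP[k0 lt_kn].
rewrite !zeta_ring_zsum ?i0 ?k0 //; apply: zsum_ring_mul; exact: ltnW.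
Qed.

Lemma coord0_mul_zeta (x : R) k : coord 0 x = 0 -> (0 < k < n)%N ->
  p_multiple (x * zeta_ring f k).
Proof.
move=> x0 hk; rewrite [x](coord_sum n_gt1 f0) mulr_suml.
elim/big_ind: _ => [||i _]; [by exists 0; rewrite mul0rn | exact: p_multipleD |].
case: i => -[|i] lt_in /=; first by rewrite x0 mulr0z mul0r; exists 0; rewrite mul0rn.
rewrite mulrzAl -mulrzr mulrC; apply: p_multipleM; exact: zeta_ring_mul.
Qed.

Lemma coord_p_multiple k (x : R) : (k < n)%N -> p_multiple x -> (p %| coord k x)%Z.
Proof.
move=> lt_kn [y ->]; rewrite pmulrn coordMz //; exact: dvdz_mull.
Qed.

Lemma coord0_sub (x : R) : coord 0 (x - (coord 0 x)%:~R) = 0.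
Proof. by rewrite coord_zmod // coord_int // subrr. Qed.

(** As zeta_i zeta_k is in p R for positive i and k, [coord 0] modulo p is a ring homomorphism from
    R to F_p; its kernel is the prime m. *)
Lemma coord0_mul (x y : R) : (p %| coord 0 (x * y) - coord 0 x * coord 0 y)%Z.
Proof.
pose x' := x - (coord 0 x)%:~R; pose y' := y - (coord 0 y)%:~R.
have -> : x * y = (coord 0 x * coord 0 y)%:~R + (y' *~ coord 0 x + x' *~ coord 0 y + x' * y').
  by rewrite rmorphM -(mulrzr y') -(mulrzr x'); exact: mul_sub_expand.
have [x0 y0] : coord 0 x' = 0 /\ coord 0 y' = 0 by rewrite !coord0_sub.
rewrite !coordD // coord_int // !coordMz // x0 y0 !mul0r !add0r addrC addKr.
apply: coord_p_multiple => //; rewrite [y'](coord_sum n_gt1 f0) mulr_sumr.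
elim/big_ind: _ => [||i _]; [by exists 0; rewrite mul0rn | exact: p_multipleD |].
case: i => -[|i] lt_in /=; first by rewrite y0 mulr0z mulr0; exists 0; rewrite mul0rn.
rewrite mulrzAr -mulrzr mulrC; apply: p_multipleM; exact: coord0_mul_zeta.
Qed.

Definition singular_ideal : pred R := fun x => (p %| coord 0 x)%Z.

Fact singular_idealE (x : R) : x \in singular_ideal = (p %| coord 0%N x)%Z.
Proof. by []. Qed.

Fact singular_idealM (x y : R) :
  x * y \in singular_ideal = (x \in singular_ideal) || (y \in singular_ideal).
Proof.
rewrite !singular_idealE -[coord 0 (x * y)](subrK (coord 0 x * coord 0 y)).
by rewrite rpredDl ?coord0_mul // !dvdzE abszM Euclid_dvdM.
Qed.

Fact singular_ideal_idealr : idealr_closed singular_ideal.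
Proof.
split=> [||a x y xI yI].
- by rewrite singular_idealE -[0]/(0%:~R) coord_int ?dvdz0.
- rewrite singular_idealE -[1]/(1%:~R) coord_int // dvdzE /=.
  by rewrite Euclid_dvd1.
- rewrite singular_idealE coordD // rpredD //.
  by have := singular_idealM a x; rewrite xI orbT singular_idealE.
Qed.
HB.instance Definition _ := isIdealr.Build R singular_ideal singular_ideal_idealr.

Fact singular_ideal_prime : prime_idealr_closed singular_ideal.
Proof. by move=> x y; rewrite singular_idealM. Qed.
HB.instance Definition _ := isPrimeIdealrClosed.Build R singular_ideal singular_ideal_prime.

Definition singular_prime : prime_idealr R := PrimeIdealr.clone R singular_ideal _.
Local Notation q := singular_prime.
Local Notation W := (fun w : R => w \notin (q : pred R)).

Definition singular_gen (i : 'I_n) : R := if val i is 0 then p%:R else zeta_ring f i.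

Lemma singular_gen_span x : x \in (q : pred R) ->
  exists t : 'I_n -> R, x = \sum_i t i * singular_gen i.
Proof.
move=> /dvdzP[m xm]; exists (fun i : 'I_n => (if val i is 0 then m else coord i x)%:~R).
rewrite {1}[x](coord_sum n_gt1 f0); apply: eq_bigr => -[[|i] lt_in] _ /=.
  by rewrite xm zeta_ring0 // rmorphM.
by rewrite -mulrzr mulrC.
Qed.

Lemma singular_gen_mem i : singular_gen i \in (q : pred R).
Proof.
case: i => -[|i] lt_in; rewrite singular_idealE /singular_gen /=.
  by rewrite -[p%:R]/(p%:Z%:~R) coord_int.
by rewrite coord_zeta.
Qed.

Lemma singular_gen_mul i k : exists t, singular_gen i * singular_gen k = p%:R * t.
Proof.
case: i => -[|i] lt_in; first by exists (singular_gen k).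
case: k => -[|k] lt_kn; first by exists (zeta_ring f i.+1); rewrite mulrC.
rewrite /singular_gen /=; have [|//|z ->] := @zeta_ring_mul i.+1 k.+1; first exact: lt_in.
by exists z; rewrite mulr_natl.
Qed.

(** Modulo p R, the term at p vanishes and t_k zeta_k is [coord 0 (t k)] times zeta_k, so the
    coordinate i of the relation is that of t_i in F_p. *)
Lemma singular_syzygy (t : 'I_n -> R) (i : 'I_n) : (0 < i)%N ->
  \sum_k t k * singular_gen k = 0 -> t i \in (q : pred R).
Proof.
move=> i_gt0 t0.
have term (k : 'I_n) : (p %| coord i (t k * singular_gen k) - coord 0 (t k) * (k == i)%:R)%Z.
  have [k0|k_gt0] := posnP k.
    have -> : k == i = false by apply/eqP => ki; rewrite -ki k0 in i_gt0.
    rewrite mulr0 subr0; apply: coord_p_multiple => //; exists (t k).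
    by rewrite /singular_gen /= k0 mulr_natr.
  have -> : singular_gen k = zeta_ring f k by case: k k_gt0 => -[].
  have -> : t k * zeta_ring f k
      = zeta_ring f k *~ coord 0 (t k) + (t k - (coord 0 (t k))%:~R) * zeta_ring f k.
    by rewrite -mulrzr [zeta_ring f k * _]mulrC -mulrDl addrC subrK.
  rewrite coordD // coordMz // coord_zeta // mulrC addrAC subrr add0r.
  apply: coord_p_multiple => //; apply: coord0_mul_zeta; first exact: coord0_sub.
  by rewrite k_gt0 ltn_ord.
rewrite singular_idealE.
pose ci (x : R) := coord i x.
have ciB : zmod_morphism ci by exact: coord_zmod.
pose ciM := GRing.isZmodMorphism.Build R int ci ciB.
pose ci' : {additive R -> int} := HB.pack ci ciM.
have := raddf0 ci'; rewrite -t0 raddf_sum /= => s0.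
have -> : coord 0 (t i) = \sum_(k < n) coord 0 (t k) * (k == i)%:R.
  rewrite (bigD1 i) //= eqxx mulr1 big1 ?addr0 // => k /negPf ->.
  by rewrite mulr0.
have : (p %| \sum_k (ci (t k * singular_gen k) - coord 0%N (t k) * (k == i)%:R))%Z.
  by apply: rpred_sum => k _; exact: term.
by rewrite sumrB s0 sub0r rpredN.
Qed.

Definition local_gen (i : 'I_n) : localization q := loc q (singular_gen i).

Lemma local_gen_cover (t : 'rV[localization q]_n) : exists2 w, W w &
  exists r : 'I_n -> R, (forall i, loc q w * t 0 i = loc q (r i)) /\
    loc q w * ideal_cover local_gen t = loc q (\sum_i r i * singular_gen i).
Proof.
have [w wW [r rP]] := loc_common_denominator (fun i => t 0 i).
exists w => //; exists r; split=> //.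
rewrite rmorph_sum /ideal_cover mulr_sumr; apply: eq_bigr => i _.
by rewrite rmorphM /= -rP mulrA.
Qed.

Lemma nonprimitive_infinite_injective_dimension : ~ gorenstein R.
Proof.
move=> [_ /(_ q)].
pose i0 := Ordinal n_gt0; pose i1 := Ordinal n_gt1; pose i2 := Ordinal n_gt2.
(* Two denominators turn a local syzygy into one over R: [w] clears the entries, and [u] makes the
   relation hold before localization. *)
have syz (i : 'I_n) : (0 < i)%N -> forall r, ideal_cover local_gen r = 0 ->
    exists t, r 0 i = ideal_cover local_gen t.
  move=> i_gt0 r r0; have [w wW [r' [rr' sum]]] := local_gen_cover r.
  move: sum; rewrite r0 mulr0 => /esym/loc_eq0[u uW u0].
  have : u * r' i \in (q : pred R).
    apply: (singular_syzygy i_gt0 (t := fun k => u * r' k)).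
    by rewrite -[RHS]u0 mulr_sumr; apply: eq_bigr => k _; rewrite mulrA.
  rewrite prime_idealrM (negPf uW) /= => /singular_gen_span[t tP].
  have [s sw] := loc_unit wW.
  exists (\row_k (s * loc q (t k))); rewrite -[LHS]mul1r -sw -mulrA rr' tP rmorph_sum.
  rewrite /ideal_cover mulr_sumr; apply: eq_bigr => k _.
  by rewrite mxE rmorphM mulrA.
apply: (@infinite_injective_dimension _ n local_gen i0 i1 i2) => //.
- move=> x px; have [w wW [r wr]] := loc_frac x.
  have /loc_eq0[u uW u0] : loc q (p%:R * r) = 0 by rewrite rmorphM /= -wr mulrCA px mulr0.
  apply: (loc_lreg wW); rewrite mulr0 wr; apply/loc_eq0; exists u => //.
  apply: (form_ring_torsion_free n_gt1 f0 p_neq0).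
  by rewrite -[_ *~ _]/(_ *+ p) -mulr_natl mulrCA.
- move=> i k; have [t e] := singular_gen_mul i k; exists (loc q t).
  by rewrite -rmorphM e rmorphM.
- exact: syz.
- exact: syz.
- move=> t t1; have [w wW [r [_]]] := local_gen_cover t; rewrite t1 mulr1 => e.
  have /loc_eq0[u uW u0] : loc q (w - \sum_i r i * singular_gen i) = 0.
    by rewrite rmorphB /= e subrr.
  have : u * w \in (q : pred R).
    move: u0; rewrite mulrBr => /eqP; rewrite subr_eq0 => /eqP ->.
    apply: idealMr; apply: rpred_sum => i _; apply: idealMr; exact: singular_gen_mem.
  by rewrite prime_idealrM (negPf uW) (negPf wW).
Qed.

End NonPrimitive.

(** * Linear substitutions *)

Section Substitution.
Implicit Types (A B P : {poly int}) (a b : int).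

(* B^d P(A/B) when P has degree at most d. *)
Definition homogenize (d : nat) (A B P : {poly int}) : {poly int} :=
  \sum_(i < d.+1) P`_i *: (A ^+ i * B ^+ (d - i)).

Lemma homogenizeD d A B P Q :
  homogenize d A B (P + Q) = homogenize d A B P + homogenize d A B Q.
Proof.
by rewrite /homogenize -big_split; apply: eq_bigr => i _; rewrite coefD scalerDl.
Qed.

Lemma homogenizeZ d A B a P : homogenize d A B (a *: P) = a *: homogenize d A B P.
Proof.
by rewrite /homogenize scaler_sumr; apply: eq_bigr => i _; rewrite coefZ scalerA.
Qed.

Lemma homogenize_sum d A B (I : finType) (F : I -> {poly int}) :
  homogenize d A B (\sum_i F i) = \sum_i homogenize d A B (F i).
Proof.
have h0 : homogenize d A B 0 = 0 by apply: big1 => i _; rewrite coef0 scale0r.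
exact: (big_morph (homogenize d A B) (homogenizeD d A B) h0).
Qed.

Lemma homogenizeM_linear d A B P a b : (size P <= d.+1)%N ->
  homogenize d.+1 A B ((a *: 'X + b%:P) * P) = (a *: A + b *: B) * homogenize d A B P.
Proof.
move=> sP; have -> : (a *: 'X + b%:P) * P = a *: ('X * P) + b *: P.
  by rewrite mulrDl -scalerAl mul_polyC.
rewrite homogenizeD !homogenizeZ mulrDl -!scalerAl; congr (a *: _ + b *: _).
  rewrite /homogenize big_ord_recl coefXM scale0r add0r mulr_sumr.
  apply: eq_bigr => i _; rewrite coefXM /= /bump /= add1n subSS -scalerAr.
  by rewrite exprS mulrA.
rewrite /homogenize big_ord_recr /= nth_default // scale0r addr0 mulr_sumr.
apply: eq_bigr => i _; have le_id : (i <= d)%N by rewrite -ltnS.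
by rewrite -scalerAr subSn // exprS mulrCA.
Qed.

Lemma homogenizeX_linear k l A B a b c d :
  (size (((a *: 'X + b%:P) ^+ k * (c *: 'X + d%:P) ^+ l)%R) <= (k + l).+1)%N /\
  homogenize (k + l) A B ((a *: 'X + b%:P) ^+ k * (c *: 'X + d%:P) ^+ l)
    = (a *: A + b *: B) ^+ k * (c *: A + d *: B) ^+ l.
Proof.
have sL (x y : int) (P : {poly int}) m : (size P <= m.+1)%N ->
    (size ((x *: 'X + y%:P) * P)%R <= m.+2)%N.
  move=> sP; apply: leq_trans (size_polyMleq _ _) _.
  have s2 : (size (x *: 'X + y%:P : {poly int})%R <= 2)%N.
    apply: leq_trans (size_polyD _ _) _; rewrite geq_max.
    rewrite (leq_trans (size_scale_leq _ _)) ?size_polyX //.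
    by rewrite (leq_trans (size_polyC_leq1 _)).
  have arith s t : (s <= 2)%N -> (t <= m.+1)%N -> ((s + t).-1 <= m.+2)%N by lia.
  exact: arith s2 sP.
elim: k => [|k [IHs IH]].
  rewrite !expr0 !mul1r add0n; elim: l => [|l [IHs IH]].
    rewrite !expr0 size_poly1; split=> //.
    by rewrite /homogenize big_ord1 coef1 eqxx scale1r !expr0 mulr1.
  by rewrite exprS; split; [exact: sL | rewrite homogenizeM_linear // IH -exprS].
rewrite addSn exprS -mulrA; split; first exact: sL.
by rewrite homogenizeM_linear // IH mulrA -exprS.
Qed.

Variables (n : nat).
Implicit Types (f : binary_form n).

(** Coefficients of [subst_form] are read at y = 1; homogenizing restores the second variable, so
    that the identity can be evaluated at an inverse substitution. *)
Lemma homogenize_subst (g : 'M[int]_2) f A B :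
  \sum_(i < n.+1) subst_form g f 0 i *: (A ^+ (n - i) * B ^+ i)
  = \sum_(i < n.+1) f 0 i *: ((g 0 0 *: A + g 0 1 *: B) ^+ (n - i) *
                              (g 1 0 *: A + g 1 1 *: B) ^+ i).
Proof.
rewrite (reindex_inj rev_ord_inj) /=.
set S := \sum_(i < n.+1) f 0 i *: ((g 0 0 *: 'X + (g 0 1)%:P) ^+ (n - i) *
       (g 1 0 *: 'X + (g 1 1)%:P) ^+ i).
transitivity (homogenize n A B S).
  apply: eq_bigr => i _; rewrite mxE /= -/S subSS subKn //.
  by rewrite -ltnS.
rewrite homogenize_sum; apply: eq_bigr => i _; rewrite homogenizeZ.
have le_in : (i <= n)%N by rewrite -ltnS.
by have := (homogenizeX_linear (n - i) i A B (g 0 0) (g 0 1) (g 1 0) (g 1 1)).2;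
  rewrite subnK // => ->.
Qed.

Lemma primitive_form_combination f f' (M : 'I_n.+1 -> 'I_n.+1 -> int) :
  (forall i, f 0 i = \sum_k f' 0 k * M i k) -> primitive_form f -> primitive_form f'.
Proof.
move=> fM [u uf]; exists (fun k => \sum_i u i * M i k); rewrite -[RHS]uf.
under eq_bigr do rewrite mulr_suml.
rewrite exchange_big; apply: eq_bigr => i _; rewrite fM mulr_sumr.
by apply: eq_bigr => k _; rewrite -mulrA [M i k * _]mulrC.
Qed.

Lemma primitive_subst_form (g : 'M[int]_2) f : g \in unitmx ->
  primitive_form (subst_form g f) <-> primitive_form f.
Proof.
move=> gU; split.
  by apply: primitive_form_combination => i; rewrite mxE coef_sum;
    apply: eq_bigr => k _; rewrite coefZ.
(* (A, B) is the inverse matrix applied to (X, 1), so [g] sends it back to (X, 1) and the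
   coefficients of [f] become combinations of those of its transform. *)
pose h := invmx g; pose A : {poly int} := h 0 0 *: 'X + (h 0 1)%:P.
pose B : {poly int} := h 1 0 *: 'X + (h 1 1)%:P.
have gh i : (g i 0 *: A + g i 1 *: B : {poly int}) = (i == 0)%:R *: 'X + ((i == 1)%:R)%:P.
  have e k : g i 0 * h 0 k + g i 1 * h 1 k = (i == k)%:R.
    have := congr1 (fun M : 'M[int]_2 => M i k) (mulmxV gU).
    rewrite !mxE big_ord_recl big_ord1 => <-; congr (_ * h _ _ + g _ _ * h _ _);
    exact/val_inj.
  by rewrite /A /B !scalerDr !scalerA addrACA -scalerDl e -!mul_polyC -!polyCM -polyCD e.
apply: (primitive_form_combination
  (M := fun i k => (A ^+ (n - k) * B ^+ k)`_(n - i))) => i.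
have := homogenize_subst g f A B; rewrite !gh /= scale1r scale0r addr0 add0r.
move=> /(congr1 (fun P : {poly int} => P`_(n - i))); rewrite !coef_sum.
have term (k : 'I_n.+1) : (f 0 k *: ('X^(n - k) * (1%:P : {poly int}) ^+ k))`_(n - i)
    = f 0 k * (k == i)%:R.
  rewrite expr1n mulr1 coefZ coefXn eq_sym; congr (_ * (nat_of_bool _)%:R).
  by rewrite -val_eqE /=; apply/eqP/eqP; have := ltn_ord i; have := ltn_ord k; lia.
under [in X in _ = X -> _]eq_bigr do rewrite term.
rewrite [X in _ = X -> _](bigD1 i) //= eqxx mulr1 [X in _ = _ + X -> _]big1;
  last by move=> k /negPf ->; rewrite mulr0.
by rewrite addr0 => <-; apply: eq_bigr => k _; rewrite coefZ.
Qed.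

End Substitution.

Theorem corollary2p5 (n : nat) (n_gt1 : (1 < n)%N) (n_neq2 : n <> 2%N)
    (f : binary_form n) (f_neq0 : f <> 0)
    (f' : binary_form n) (ff' : defines_ring f f') :
  gorenstein (form_ring f') <-> primitive_form f.
Proof.
have n_gt2 : (2 < n)%N by case: n n_gt1 n_neq2 {f f_neq0 f' ff'} => [|[|[|]]].
have [f'0 prim] : f' 0 0 != 0 /\ (primitive_form f' <-> primitive_form f).
  by case: ff' => [f0|g _ gU g0]; split=> //; exact: primitive_subst_form.
split=> [gor|/prim prim'].
  apply/prim; apply: boolp.contrapT => /(not_primitive_prime f'0)[p p_prime pf'].
  exact: (nonprimitive_infinite_injective_dimension n_gt2 f'0 p_prime pf') gor.
split=> [|q]; first exact: form_ring_noetherian.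
exact: primitive_finite_injective_dimension.
Qed.
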